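(* Let $G$ be a finite simple graph and let $H$ be a subgraph of $G$. Set $I=I(H)$ and $J=I(G)$, edge ideals in $R=\mathbb{K}[x_1,\ldots,x_n]$. Then $\operatorname{reg}(IJ)\le \operatorname{m}(G)+3$, where $\operatorname{m}(G)$ is the matching number of $G$.
   Context: $\mathbb{K}$ is a field and $R=\mathbb{K}[x_1,\ldots,x_n]$ is standard graded. All graphs are finite, simple, without isolated vertices, with vertices among $x_1,\ldots,x_n$, and with at least one edge. The edge ideal of $G$ is $I(G)=(x_ix_j \mid \{x_i,x_j\}\in E(G))\subset R$. For a finitely generated graded $R$-module $M$ with graded Betti numbers $\beta_{i,j}(M)$, $\operatorname{reg}(M)=\max\{j-i\mid \beta_{i,j}(M)\ne 0\}$. The matching number $\operatorname{m}(G)$ is the maximum number of pairwise disjoint edges of $G$. *)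

(* Defs.v *)
From HB Require Import structures.
From mathcomp Require Import all_boot all_order all_algebra.
From mathcomp Require Import mpoly.
Set Implicit Arguments.
Unset Strict Implicit.
Unset Printing Implicit Defensive.
Import Order.TTheory GRing.Theory Num.Theory.
Local Open Scope ring_scope.

(* Vertices are the indices of the variables.  The vertex set is kept explicit
   although it is determined by the edges in the absence of isolated vertices. *)
Record graph (n : nat) := Graph {
  vertices : {set 'I_n};
  edges : {set {set 'I_n}};
  edge_card2 : forall e, e \in edges -> #|e| = 2%N;
  edge_vertices : forall e, e \in edges -> e \subset vertices;
  no_isolated : forall v, v \in vertices -> exists2 e, e \in edges & v \in e;
  has_edge : edges != set0
}.

Definition subgraph (n : nat) (H G : graph n) : Prop :=
  vertices H \subset vertices G /\ edges H \subset edges G.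

Definition is_matching (n : nat) (G : graph n) (M : {set {set 'I_n}}) : bool :=
  (M \subset edges G) && trivIset M.

Definition matching_number (n : nat) (G : graph n) : nat :=
  \max_(M : {set {set 'I_n}} | is_matching G M) #|M|.

Definition ideal_gen (R : comNzRingType) (S : R -> Prop) : R -> Prop :=
  fun p => exists (m : nat) (c g : 'I_m -> R),
    (forall i, S (g i)) /\ p = \sum_(i < m) c i * g i.

Definition ideal_prod (R : comNzRingType) (I J : R -> Prop) : R -> Prop :=
  ideal_gen (fun p => exists a b, [/\ I a, J b & p = a * b]).

Definition edge_ideal (K : fieldType) (n : nat) (G : graph n) :
    {mpoly K[n]} -> Prop :=
  ideal_gen (fun p => exists i j : 'I_n,
    [set i; j] \in edges G /\ p = 'X_i * 'X_j).

(* F_i is the direct sum over k < frank i of the modules R(- fshift i k), where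
   R = K[x_1, ..., x_n]; its elements are row vectors, and maps act by right
   multiplication.  The differential fdiff i goes from F_{i+1} to F_i, and faug
   from F_0 to R.  Natural number shifts are enough for resolutions of ideals
   of R. *)
Record free_complex (K : fieldType) (n : nat) := FreeComplex {
  frank : nat -> nat;
  fshift : forall i : nat, 'I_(frank i) -> nat;
  fdiff : forall i : nat, 'M[{mpoly K[n]}]_(frank i.+1, frank i);
  faug : 'cV[{mpoly K[n]}]_(frank 0)
}.

(* All maps are homogeneous of degree 0. *)
Definition fgraded (K : fieldType) (n : nat) (F : free_complex K n) : Prop :=
  (forall k (m : 'X_{1..n}), m \in msupp (faug F k ord0) ->
     mdeg m = fshift k)
  /\ (forall i k l (m : 'X_{1..n}), m \in msupp (fdiff F i k l) ->
     (mdeg m + fshift l)%N = fshift k).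

Definition fexact (K : fieldType) (n : nat) (F : free_complex K n)
    (I : {mpoly K[n]} -> Prop) : Prop :=
  [/\ forall p, I p <-> exists u : 'rV_(frank F 0), p = (u *m faug F) ord0 ord0,
      forall u : 'rV_(frank F 0),
        u *m faug F = 0 <-> exists v, u = v *m fdiff F 0
    & forall i (u : 'rV_(frank F i.+1)),
        u *m fdiff F i = 0 <-> exists v, u = v *m fdiff F i.+1].

(* The image of F_{i+1} lies in (x_1, ..., x_n) F_i. *)
Definition fminimal (K : fieldType) (n : nat) (F : free_complex K n) : Prop :=
  forall i k l, (fdiff F i k l)@_0%MM = 0.

Definition minimal_free_resolution (K : fieldType) (n : nat)
    (I : {mpoly K[n]} -> Prop) (F : free_complex K n) : Prop :=
  [/\ fgraded F, fexact F I & fminimal F].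

(* graded_betti I i j b means beta_{i,j}(I) = b, for the ideal I (and not R/I)
   as a graded module: b is the number of summands R(-j) in F_i. *)
Definition graded_betti (K : fieldType) (n : nat)
    (I : {mpoly K[n]} -> Prop) (i j b : nat) : Prop :=
  exists F : free_complex K n,
    minimal_free_resolution I F /\ b = #|[set k | @fshift K n F i k == j]|.

(* reg(I) = r.  The first clause includes the existence of a minimal graded
   free resolution, the second one ranges over all of them; hence r is unique. *)
Definition regularity (K : fieldType) (n : nat)
    (I : {mpoly K[n]} -> Prop) (r : int) : Prop :=
  (exists i j b : nat,
     [/\ graded_betti I i j b, b <> 0%N & r = j%:Z - i%:Z])
  /\ (forall i j b : nat,
     graded_betti I i j b -> b <> 0%N -> j%:Z - i%:Z <= r).

(* Main.v *)
(* Regularity is bounded through Koszul homology.  If [F] is a minimal graded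
   free resolution of [I], a chase in the double complex Koszul (x) F turns a
   generator of [F_i] of degree [j] into a Koszul cycle on [I] of exterior degree
   [i] and total degree [j]; if that cycle is a boundary, the generator lies in
   [m F_i], a contradiction.  For monomial ideals, Mayer-Vietoris then gives
     reg Q <= max (reg (Q : e) + deg e, reg (Q + (e)))
   for a monomial [e].  Applied to [I(H)I(G)] and the edges [e = ab] of [H] one
   after the other, it leads to [I(H)] and to colon ideals generated by variables,
   the edges of [G], and the products [x_u x_v] with [u] adjacent to [a] and [v] to
   [b].  Colons by [x_a] and [x_b] kill the latter products, lower the matching
   number, and leave edge ideals of vertex-deleted subgraphs, where the same colon
   by vertices gives reg <= m + 1.  Adding both [x_a] and [x_b] instead also lowers
   the matching number, and the remaining products cost at most one.

   A minimal resolution exists because submodules of free modules are finitely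
   generated (Dickson's lemma), and a homogeneous generating family with the
   fewest elements has no syzygy with a nonzero constant coefficient. *)
Require Import Defs.
From HB Require Import structures.
From Stdlib Require Import Classical ClassicalEpsilon.
From mathcomp Require Import all_boot all_order all_algebra.
From mathcomp Require Import mpoly zify.
Set Implicit Arguments.
Unset Strict Implicit.
Unset Printing Implicit Defensive.
Import Order.TTheory GRing.Theory Num.Theory.
Local Open Scope ring_scope.

(** * Koszul complexes with coefficients in a module *)

Section Koszul.
Variables (R : comNzRingType) (x : nat -> R).

(* [kos M k] is the total Koszul complex of [x 0, ..., x (k - 1)] with
   coefficients in [M], all exterior degrees together, built as an iterated
   mapping cone. *)
Fixpoint kos (M : lmodType R) (k : nat) : lmodType R :=
  if k is k'.+1 then (kos M k' * kos M k')%type else M.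

Fixpoint kdiff (M : lmodType R) (k : nat) : kos M k -> kos M k :=
  if k is k'.+1
  then fun z => (kdiff z.1 + x k' *: z.2, - kdiff z.2)
  else fun=> 0.

Fixpoint kall (M : lmodType R) (P : M -> Prop) (k : nat) : kos M k -> Prop :=
  if k is k'.+1 then fun z => kall P z.1 /\ kall P z.2 else P.

Fixpoint kmap (M N : lmodType R) (f : M -> N) (k : nat) : kos M k -> kos N k :=
  if k is k'.+1 then fun z => (kmap f z.1, kmap f z.2) else f.

(** The second component of each pair carries a new exterior generator, so nested first components
    form exterior degree 0, where [kbase] embeds and which [kcoef0] reads off. *)
Fixpoint kbase (M : lmodType R) (k : nat) : M -> kos M k :=
  if k is k'.+1 then fun u => (kbase k' u, 0) else id.

Fixpoint kcoef0 (M : lmodType R) (k : nat) : kos M k -> M :=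
  if k is k'.+1 then fun z => kcoef0 z.1 else id.

Lemma kdiff_is_linear M k : linear (@kdiff M k).
Proof.
elim: k => [|k IHk] c; first by move=> u v; rewrite /= scaler0 addr0.
move=> [u1 u2] [v1 v2].
rewrite /kdiff -/kdiff.
have -> : c *: (u1, u2) + (v1, v2) = (c *: u1 + v1, c *: u2 + v2) :> kos M k.+1 by [].
congr pair; rewrite /= IHk.
- rewrite !scalerDr !scalerA [x k * c]mulrC.
  by rewrite addrACA.
- by rewrite opprD scalerN.
Qed.
HB.instance Definition _ M k :=
  GRing.isLinear.Build R (kos M k) (kos M k) _ (@kdiff M k) (@kdiff_is_linear M k).

Lemma kdiffS M k (a b : kos M k) :
  @kdiff M k.+1 (a, b) = (kdiff a + x k *: b, - kdiff b).
Proof. by []. Qed.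

Lemma kdiffD M k : {morph @kdiff M k : z w / z + w}.
Proof. exact: linearD. Qed.

Lemma kdiffN M k : {morph @kdiff M k : z / - z}.
Proof. exact: linearN. Qed.

Lemma kdiffB M k : {morph @kdiff M k : z w / z - w}.
Proof. exact: linearB. Qed.

Lemma kdiffZ M k c : {morph @kdiff M k : z / c *: z}.
Proof. by move=> z; apply: linearZ. Qed.

Lemma kdiffK M k (z : kos M k) : kdiff (kdiff z) = 0.
Proof.
elim: k z => [|k IHk] // [a b].
rewrite !kdiffS; congr pair; last by rewrite kdiffN IHk !oppr0.
by rewrite kdiffD kdiffZ IHk add0r scalerN subrr.
Qed.

Lemma kmap_is_linear (M N : lmodType R) (f : {linear M -> N}) k :
  linear (@kmap M N f k).
Proof.
elim: k => [|k IHk] c; first exact: linearP.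
move=> [u1 u2] [v1 v2].
by congr pair; rewrite -IHk.
Qed.
HB.instance Definition _ (M N : lmodType R) (f : {linear M -> N}) k :=
  GRing.isLinear.Build R (kos M k) (kos N k) _ (@kmap M N f k)
    (@kmap_is_linear M N f k).

Lemma kmapD (M N : lmodType R) (f : {linear M -> N}) k :
  {morph @kmap M N f k : z w / z + w}.
Proof. exact: linearD. Qed.

Lemma kmapN (M N : lmodType R) (f : {linear M -> N}) k :
  {morph @kmap M N f k : z / - z}.
Proof. exact: linearN. Qed.

Lemma kmapB (M N : lmodType R) (f : {linear M -> N}) k :
  {morph @kmap M N f k : z w / z - w}.
Proof. exact: linearB. Qed.

Lemma kmapZ (M N : lmodType R) (f : {linear M -> N}) k c :
  {morph @kmap M N f k : z / c *: z}.
Proof. by move=> z; apply: linearZ. Qed.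

Lemma kmapS (M N : lmodType R) (f : M -> N) k (a b : kos M k) :
  @kmap M N f k.+1 (a, b) = (kmap f a, kmap f b).
Proof. by []. Qed.

Lemma kmap_diff (M N : lmodType R) (f : {linear M -> N}) k (z : kos M k) :
  kmap f (kdiff z) = kdiff (kmap f z).
Proof.
elim: k z => [|k IHk]; first by move=> z; apply: linear0.
move=> [a b]; rewrite kdiffS !kmapS kdiffS -!IHk.
by rewrite kmapD kmapZ kmapN.
Qed.

Lemma kall_impl (M : lmodType R) (P Q : M -> Prop) k (z : kos M k) :
  (forall u, P u -> Q u) -> kall P z -> kall Q z.
Proof.
move=> PQ; elim: k z => [|k IHk] z /=; first exact: PQ.
by case=> /IHk ? /IHk.
Qed.

Lemma kall_and (M : lmodType R) (P Q : M -> Prop) k (z : kos M k) :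
  kall P z -> kall Q z -> kall (fun u => P u /\ Q u) z.
Proof. by elim: k z => [|k IHk] // [a b] [? ?] [? ?]; split; apply: IHk. Qed.

Lemma kall_eq0 (M : lmodType R) k (z : kos M k) : kall (fun u => u = 0) z -> z = 0.
Proof. by elim: k z => [|k IHk] // [a b] /= [/IHk -> /IHk ->]. Qed.

Lemma kall_true (M : lmodType R) (P : M -> Prop) k (z : kos M k) :
  (forall u, P u) -> kall P z.
Proof. by move=> PT; elim: k z => [|k IHk] z /=. Qed.

Lemma kall_scale (M : lmodType R) (P Q : M -> Prop) c k (z : kos M k) :
  (forall u, P u -> Q (c *: u)) -> kall P z -> kall Q (c *: z).
Proof.
move=> PQ; elim: k z => [|k IHk] z; first exact: PQ.
by case: z => a b [Pa Pb]; split; apply: IHk.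
Qed.

Lemma kall_add (M : lmodType R) (P Q S : M -> Prop) k (z w : kos M k) :
  (forall u v, P u -> Q v -> S (u + v)) -> kall P z -> kall Q w -> kall S (z + w).
Proof.
move=> PQ; elim: k z w => [|k IHk]; first by move=> u v; apply: PQ.
by move=> [a b] [a' b'] [Pa Pb] [Qa Qb]; split; apply: IHk.
Qed.

Lemma kall_sub (M : lmodType R) (P : M -> Prop) k (z w : kos M k) :
  (forall u v, P u -> P v -> P (u - v)) -> kall P z -> kall P w -> kall P (z - w).
Proof.
move=> PB; elim: k z w => [|k IHk]; first by move=> u v; apply: PB.
by move=> [a b] [a' b'] [Pa Pb] [Qa Qb]; split; apply: IHk.
Qed.

Lemma kall0 (M : lmodType R) (P : M -> Prop) k : P 0 -> kall P (0 : kos M k).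
Proof. by move=> P0; elim: k. Qed.

Lemma kall_diff (M : lmodType R) (P Q : M -> Prop) k (z : kos M k) :
  Q 0 -> (forall u v, Q u -> Q v -> Q (u - v)) ->
  (forall i u, (i < k)%N -> P u -> Q (x i *: u)) ->
  kall P z -> kall Q (kdiff z).
Proof.
move=> Q0 QB; have QN u : Q u -> Q (- u) by rewrite -sub0r; apply: QB.
have QD u v : Q u -> Q v -> Q (u + v) by move=> Qu /QN Qv; rewrite -[v]opprK; apply: QB.
have kQ0 j : kall Q (0 : kos M j) by apply: kall0.
elim: k z => [|k IHk] //.
move=> [a b] PQ [Pa Pb]; have IH u (Pu : kall P u) := IHk u (fun i v ik => PQ i v (ltnW ik)) Pu.
split => /=.
- apply: (kall_add QD); first exact: IH.
  by apply: kall_scale Pb => u; apply: PQ.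
- by rewrite -sub0r; apply: kall_sub => //; apply: IH.
Qed.

(** Used with [c = 1] to split along two ideals, and with [c] a monomial to divide coefficients. *)
Lemma kall_split (M : lmodType R) (P Q S : M -> Prop) c k (z : kos M k) :
  (forall u, P u -> exists v w, [/\ u = v + c *: w, Q v & S w]) -> kall P z ->
  exists v w, [/\ z = v + c *: w, kall Q v & kall S w].
Proof.
move=> PQS; elim: k z => [|k IHk]; first exact: PQS.
move=> [a b] /= [/IHk [v [w [-> Qv Sw]]] /IHk [v' [w' [-> Qv' Sw']]]].
by exists (v, v'), (w, w').
Qed.

Lemma kall_disjoint (M : lmodType R) (P : M -> Prop) c k (z w : kos M k) :
  (forall u v, P u -> u + c *: v = 0 -> u = 0 /\ v = 0) ->
  kall P z -> z + c *: w = 0 -> z = 0 /\ w = 0.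
Proof.
move=> PQ; elim: k z w => [|k IHk]; first exact: PQ.
move=> [a b] [a' b'] [Pa Pb] [ea eb].
have [-> ->] := IHk a a' Pa ea.
by have [-> ->] := IHk b b' Pb eb.
Qed.

Lemma kall_lift (M N : lmodType R) (f : M -> N) (P : N -> Prop) (Q : M -> Prop) k
    (z : kos N k) :
  (forall v, P v -> exists2 u, Q u & v = f u) -> kall P z ->
  exists2 y, kall Q y & z = kmap f y.
Proof.
move=> PQ; elim: k z => [|k IHk]; first exact: PQ.
move=> [a b] /= [/IHk [u Qu ->] /IHk [v Qv ->]].
by exists (u, v).
Qed.

Lemma kall_map (M N : lmodType R) (f : M -> N) (P : M -> Prop) (Q : N -> Prop) k
    (z : kos M k) :
  (forall u, P u -> Q (f u)) -> kall P z -> kall Q (kmap f z).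
Proof.
move=> PQ; elim: k z => [|k IHk] z; first exact: PQ.
by case=> /IHk ? /IHk.
Qed.

Lemma kmap_comp0 (M N L : lmodType R) (f : {linear M -> N}) (g : {linear N -> L}) k
    (z : kos M k) :
  (forall u, g (f u) = 0) -> kmap g (kmap f z) = 0.
Proof.
move=> gf0; elim: k z => [|k IHk] z //=; by rewrite !IHk.
Qed.

Lemma kmap_ker (M N : lmodType R) (f : M -> N) k (z : kos M k) :
  kmap f z = 0 <-> kall (fun u => f u = 0) z.
Proof.
elim: k z => [|k IHk] //= [a b]; rewrite -!IHk.
by split=> [[-> ->]|[-> ->]].
Qed.

Lemma kdiff_base (M : lmodType R) k (u : M) : kdiff (kbase k u) = 0.
Proof.
elim: k => [|k IHk]; first exact: erefl.
change (kdiff ((kbase k u, 0) : kos M k.+1) = 0).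
rewrite kdiffS IHk -[X in (_, - kdiff X)](subrr 0) kdiffB subrr oppr0.
by rewrite scaler0 addr0.
Qed.

Lemma kcoef0_base (M : lmodType R) k (u : M) : kcoef0 (kbase k u) = u.
Proof. by elim: k. Qed.

Lemma kall_coef0 (M : lmodType R) (P : M -> Prop) k (z : kos M k) :
  kall P z -> P (kcoef0 z).
Proof. by elim: k z => [|k IHk] // [a b] [/IHk]. Qed.

Lemma kall_base (M : lmodType R) (P : M -> Prop) k (u : M) :
  P 0 -> P u -> kall P (kbase k u).
Proof.
move=> P0 Pu; elim: k => [|k IHk] //=; split=> //.
by elim: (k).
Qed.
End Koszul.

(** * Polynomials controlled by their supports *)

Section Support.
Variables (K : fieldType) (n : nat).
Implicit Types (p q : {mpoly K[n]}) (m e : 'X_{1..n}) (Q : pred 'X_{1..n}).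

Definition supp_in Q p : Prop := forall m, m \in msupp p -> Q m.

Lemma supp_in0 Q : supp_in Q 0.
Proof. by move=> m; rewrite mcoeff_msupp mcoeff0 eqxx. Qed.

Lemma supp_inD Q p q : supp_in Q p -> supp_in Q q -> supp_in Q (p + q).
Proof. by move=> Qp Qq m /msuppD_le; rewrite mem_cat => /orP[/Qp|/Qq]. Qed.

Lemma supp_inN Q p : supp_in Q p -> supp_in Q (- p).
Proof. by move=> Qp m; rewrite (perm_mem (msuppN p)) => /Qp. Qed.

Lemma supp_inB Q p q : supp_in Q p -> supp_in Q q -> supp_in Q (p - q).
Proof. by move=> Qp Qq; apply/supp_inD/supp_inN. Qed.

Lemma supp_inW Q1 Q2 p : (forall m, Q1 m -> Q2 m) -> supp_in Q1 p -> supp_in Q2 p.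
Proof. by move=> Q12 Qp m /Qp/Q12. Qed.

Lemma supp_in_sum Q (I : eqType) (s : seq I) (P : pred I) (F : I -> {mpoly K[n]}) :
  (forall i, i \in s -> P i -> supp_in Q (F i)) -> supp_in Q (\sum_(i <- s | P i) F i).
Proof.
move=> QF; rewrite big_seq_cond; elim/big_ind: _ => [|p q|i /andP[]].
- exact: supp_in0.
- exact: supp_inD.
- exact: QF.
Qed.

Lemma supp_in_monom Q c m : Q m -> supp_in Q (c *: 'X_[m]).
Proof. by move=> Qm m' /msuppZ_le; rewrite msuppX inE => /eqP->. Qed.

Lemma supp_inMX Q1 Q2 e p :
  (forall m, Q1 m -> Q2 (e + m)%MM) -> supp_in Q1 p -> supp_in Q2 ('X_[e] * p).
Proof.
move=> Q12 Qp m; rewrite mulrC (perm_mem (msuppMX _ _)).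
by case/mapP=> m' /Qp/Q12 Qm' ->.
Qed.

Lemma supp_inM Q1 Q2 c p :
  (forall m m', Q1 m -> Q2 (m' + m)%MM) -> supp_in Q1 p -> supp_in Q2 (c * p).
Proof.
move=> Q12 Qp m /msuppM_le /allpairsP[[m1 m2] /= [_ /Qp Qm2 ->]].
exact: Q12.
Qed.

Lemma supp_in_split Q1 Q2 p : supp_in (predU Q1 Q2) p ->
  exists a b, [/\ p = a + b, supp_in Q1 a & supp_in Q2 b].
Proof.
move=> Qp; exists (\sum_(m <- msupp p | Q1 m) p@_m *: 'X_[m]).
exists (\sum_(m <- msupp p | ~~ Q1 m) p@_m *: 'X_[m]); split.
- by rewrite {1}[p]mpolyE (bigID Q1).
- by apply: supp_in_sum => m _ Q1m; apply: supp_in_monom.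
- apply: supp_in_sum => m /Qp /orP[Q1m|Q2m] nQ1m; last exact: supp_in_monom.
  by rewrite Q1m in nQ1m.
Qed.

Lemma supp_in_div e p : supp_in (fun m => (e <= m)%MM) p ->
  exists2 q, p = 'X_[e] * q & supp_in (fun m => (e + m)%MM \in msupp p) q.
Proof.
move=> ep; exists (\sum_(m <- msupp p) p@_m *: 'X_[(m - e)%MM]).
- rewrite {1}[p]mpolyE mulr_sumr !big_seq; apply: eq_bigr => m /ep em.
  by rewrite -scalerAr -mpolyXD addmC submK.
- apply: supp_in_sum => m mp _; apply: supp_in_monom.
  by rewrite addmC submK // ep.
Qed.

Lemma supp_in_disjoint Q e p q :
  (forall m, Q m -> ~~ (e <= m)%MM) -> supp_in Q p -> p + 'X_[e] * q = 0 ->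
  p = 0 /\ q = 0.
Proof.
move=> Qe Qp pq0; suff p0 : p = 0.
  split=> //; apply/eqP; move/eqP: pq0; rewrite p0 add0r mulf_eq0.
  by have /negPf-> : 'X_[e] != 0 :> {mpoly K[n]} by rewrite -msupp_eq0 msuppX.
apply/mpolyP => m; rewrite mcoeff0; case: (boolP (m \in msupp p)) => [mp|]; last first.
  exact: memN_msupp_eq0.
have := Qe m (Qp m mp); have /eqP := pq0; rewrite addr_eq0 => /eqP -> nem.
rewrite memN_msupp_eq0 // (perm_mem (msuppN _)) mulrC (perm_mem (msuppMX _ _)).
by apply: contra nem => /mapP[m' _ ->]; apply: lem_addr.
Qed.

End Support.

(** * Koszul homology and regularity of monomial ideals *)

Section Acyclic.
Variables (K : fieldType) (n : nat).
Local Notation R := {mpoly K[n]}.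
Implicit Types (p q : R) (m e : 'X_{1..n}) (Q : pred 'X_{1..n}).

Definition kvar (i : nat) : R := if insub i is Some j then 'X_(j : 'I_n) else 0.

Lemma kvarE i (lt_in : (i < n)%N) : kvar i = 'X_(Ordinal lt_in).
Proof. by rewrite /kvar insubT. Qed.

Local Notation kin Q := (@kall _ R^o (supp_in Q) _).

Definition degge (d : nat) : pred 'X_{1..n} := fun m => (d <= mdeg m)%N.

Lemma degge_kvar Q1 Q2 (i : nat) p :
  (forall j m, i = val j -> Q1 m -> Q2 (U_(j) + m)%MM) -> supp_in Q1 p -> supp_in Q2 (kvar i * p).
Proof.
rewrite /kvar; case: insubP => [j _ ji|_] Q12; last by rewrite mul0r => _; apply: supp_in0.
by apply: supp_inMX => m; apply: Q12.
Qed.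

Lemma kinD Q k (z w : kos R^o k) : kin Q z -> kin Q w -> kin Q (z + w).
Proof. by apply: kall_add => u v; apply: supp_inD. Qed.

Lemma kinB Q k (z w : kos R^o k) : kin Q z -> kin Q w -> kin Q (z - w).
Proof. by apply: kall_sub => u v; apply: supp_inB. Qed.

(** The only Koszul homology of the polynomial ring is in exterior degree 0, and coefficients in the
    ideal of the first [k] variables make that class vanish. Induction on [k]: split [a] as a1 + x_k
    a2 with x_k absent from [a1]; a primitive of [a1], paired with [a2], is a primitive of [z]. *)
Lemma koszul_acyclic k d (z : kos R^o k) : (k <= n)%N ->
  kin (fun m => degge d m && [exists i : 'I_n, (i < k)%N && (m i != 0%N)]) z ->
  kdiff kvar z = 0 -> exists2 y : kos R^o _, kin (degge d.-1) y & kdiff kvar y = z.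
Proof.
elim: k z => [|k IHk] z lt_kn.
  move=> Qz _; exists 0; first exact: supp_in0.
  apply: esym; apply/mpolyP => m; rewrite mcoeff0 memN_msupp_eq0 //.
  apply/negP => /Qz /andP[_ /existsP[i]]; by rewrite ltn0.
case: z => a b [Qa _]; rewrite kdiffS => -[dab _].
pose v := Ordinal lt_kn.
have [a1 [a2 [def_a Qa1 Qa2]]] : exists a1 a2, [/\ a = a1 + kvar k *: a2,
    kin (fun m => [&& degge d m, [exists i : 'I_n, (i < k)%N && (m i != 0%N)]
       & m v == 0%N]) a1
  & kin (degge d.-1) a2].
  apply: kall_split Qa => p Qp.
  have [|p1 [p2 [def_p Qp1 Qp2]]] := @supp_in_split _ _
      (fun m => [&& degge d m, [exists i : 'I_n, (i < k)%N && (m i != 0%N)] & m v == 0%N])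
      (fun m => degge d m && (U_(v) <= m)%MM) p.
    move=> m /Qp /andP[/= dm /existsP[i /andP[ik mi]]].
    case: (posnP (m v)) => [mv0|mv]; last by rewrite /= lep1mP -lt0n mv dm orbT.
    rewrite /= dm ?eqxx /= ?andbT orbC; apply/orP; right; apply/existsP; exists i; rewrite mi andbT.
    move: ik; rewrite ltnS leq_eqVlt => /orP[/eqP ik|//].
    by rewrite (_ : i = v) ?mv0 // in mi; apply: val_inj.
  have [|q def_p2 Qq] := @supp_in_div _ _ U_(v)%MM p2.
    by move=> m /Qp2 /andP[].
  exists p1, q; split=> //; first by rewrite def_p def_p2 kvarE.
  move=> m /Qq/Qp2/andP[]; rewrite /degge mdegD mdeg1 add1n => + _.
  by case: (d).
(* The cycle condition reads d(a1) + x_k (d(a2) + b) = 0. The differential of [a1] only brings in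
   earlier variables, so x_k is still absent from it and both terms vanish. *)
have [da1 db] : kdiff kvar a1 = 0 /\ kdiff kvar a2 + b = 0.
  apply: (@kall_disjoint _ R^o (supp_in (fun m => m v == 0%N)) (kvar k)).
  - move=> p q Qp; rewrite kvarE -/v; apply: supp_in_disjoint Qp => m.
    by rewrite lep1mP negbK.
  - apply: kall_diff Qa1.
    + exact: supp_in0.
    + exact: supp_inB.
    + move=> i u ik; apply: degge_kvar => j m ij /and3P[_ _ /eqP mv].
      by rewrite mnmDE mnm1E mv addn0 -val_eqE /= -ij (ltn_eqF ik).
  - by rewrite scalerDr addrA -kdiffZ -kdiffD -def_a.
have [|y Qy def_y] := IHk a1 (ltnW lt_kn) _ da1.
  by apply: kall_impl Qa1 => u; apply: supp_inW => m /and3P[-> -> _].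
exists (y, a2); first by [].
by rewrite kdiffS def_y def_a; congr pair; apply/eqP; rewrite eq_sym -addr_eq0 addrC db.
Qed.

(* [regle Q r] says that the monomial ideal spanned by the monomials in [Q] has
   regularity at most [r], in terms of its Koszul homology.  The bound [d] on
   the degrees of the coefficients replaces the grading: a cycle in exterior
   degree [i] whose coefficients have degree at least [d] has total degree at
   least [i + d]. *)
Definition regle Q (r : nat) : Prop :=
  forall d (z : kos R^o n), (r < d)%N ->
    kin (predI Q (degge d)) z -> kdiff kvar z = 0 ->
  exists2 y : kos R^o _, kin (predI Q (degge d.-1)) y & kdiff kvar y = z.

Lemma eq_regle Q1 Q2 r : Q1 =1 Q2 -> regle Q1 r -> regle Q2 r.
Proof.
move=> Q12 reg1 d z rd Qz dz; have [|y Qy <-] := reg1 d z rd _ dz.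
  by apply: kall_impl Qz => u; apply: supp_inW => m /=; rewrite Q12.
by exists y => //; apply: kall_impl Qy => u; apply: supp_inW => m /=; rewrite Q12.
Qed.

Lemma regleW Q r s : (r <= s)%N -> regle Q r -> regle Q s.
Proof. by move=> rs regQ d z sd; apply: regQ; apply: leq_ltn_trans sd. Qed.

Lemma regle_empty Q r : (forall m, ~~ Q m) -> regle Q r.
Proof.
move=> Q0 d z _ Qz _; exists z; last first.
  have -> : z = 0; last exact: linear0.
  apply: kall_eq0; apply: kall_impl Qz => u Qu.
  apply/mpolyP => m; rewrite mcoeff0 memN_msupp_eq0 //.
  by apply/negP => /Qu /andP[]; rewrite (negPf (Q0 m)).
by apply: kall_impl Qz => u; apply: supp_inW => m /=; rewrite (negPf (Q0 m)).
Qed.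

Lemma regleT : regle predT 0.
Proof.
move=> d z d0 Qz dz; have [|y Qy <-] := koszul_acyclic (d := d) (leqnn n) _ dz.
  apply: kall_impl Qz => u; apply: supp_inW => m /= dm; rewrite dm /=.
  have : mdeg m != 0%N by rewrite -lt0n (leq_trans d0).
  rewrite mdeg_eq0; apply: contraNT; rewrite negb_exists => /forallP m0.
  by apply/eqP/mnmP => i; have := m0 i; rewrite ltn_ord /= negbK mnm0E => /eqP.
by exists y => //; apply: kall_impl Qy => u; apply: supp_inW.
Qed.

Lemma kdiff_degge Q d k (z : kos R^o k) : (forall m m', Q m -> Q (m' + m)%MM) ->
  kin (predI Q (degge d)) z -> kin (predI Q (degge d.+1)) (kdiff kvar z).
Proof.
move=> Qup; apply: kall_diff.
- exact: supp_in0.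
- exact: supp_inB.
- move=> i u _; apply: degge_kvar => j m _ /andP[Qm]; rewrite /= Qup //=.
  by rewrite /degge mdegD mdeg1 add1n ltnS.
Qed.

Lemma kall_supp_inI Q1 Q2 d k (z : kos R^o k) :
  kin (predI Q1 (degge d)) z -> kin (predI Q2 (degge d)) z ->
  kin (predI (predI Q1 Q2) (degge d)) z.
Proof.
move=> Qz1 Qz2; apply: kall_impl (kall_and Qz1 Qz2) => u [Qu1 Qu2] m mu.
by have /andP[/= -> ->] := Qu1 m mu; have /andP[/= -> _] := Qu2 m mu.
Qed.

(** Mayer-Vietoris: writing a cycle as a + b along the two ideals, the connecting map sends it to
    d(a), which lies in the intersection. The differential raises coefficient degrees by one, hence
    [r.+1] there. *)
Lemma regle_union Q1 Q2 r :
  (forall m m', Q1 m -> Q1 (m' + m)%MM) -> (forall m m', Q2 m -> Q2 (m' + m)%MM) ->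
  regle Q1 r -> regle Q2 r -> regle (predI Q1 Q2) r.+1 -> regle (predU Q1 Q2) r.
Proof.
move=> up1 up2 reg1 reg2 reg12 d z rd Qz dz.
have [a [b [def_z Qa Qb]]] : exists a b, [/\ z = a + 1 *: b,
    kin (predI Q1 (degge d)) a & kin (predI Q2 (degge d)) b].
  apply: kall_split Qz => p Qp.
  have [|a [b [-> Qa Qb]]] := @supp_in_split _ _ (predI Q1 (degge d)) (predI Q2 (degge d)) p.
    by move=> m /Qp /andP[/orP[]Qm dm]; rewrite /= Qm dm ?orbT.
  by exists a, b; rewrite scale1r.
rewrite scale1r in def_z.
have eq_d : kdiff kvar a = - kdiff kvar b by apply/eqP; rewrite -addr_eq0 -kdiffD -def_z dz.
have [||c Qc def_c] := reg12 d.+1 (kdiff kvar a) _ _ (kdiffK _ _); first by [].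
  suff [Q1da Q2da] : kin (predI Q1 (degge d.+1)) (kdiff kvar a) /\
        kin (predI Q2 (degge d.+1)) (kdiff kvar a).
    exact: kall_supp_inI.
  split; first exact: kdiff_degge.
  by rewrite eq_d -kdiffN; apply: kdiff_degge => //; rewrite -scaleN1r;
    apply: kall_scale Qb => u; rewrite scaleN1r; apply: supp_inN.
(* The primitive [c] in the intersection corrects both halves to cycles. *)
have [||ya Qya dya] := reg1 d (a - c) rd.
- apply: kinB => //.
  by apply: kall_impl Qc => u; apply: supp_inW => m /andP[/andP[Q1m _] dm]; apply/andP.
- by rewrite kdiffB def_c subrr.
have [||yb Qyb dyb] := reg2 d (b + c) rd.
- apply: kinD => //.
  by apply: kall_impl Qc => u; apply: supp_inW => m /andP[/andP[_ Q2m] dm]; apply/andP.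
- by rewrite kdiffD def_c eq_d subrr.
exists (ya + yb); last by rewrite kdiffD dya dyb def_z addrACA addNr addr0.
by apply: kinD; [apply: kall_impl Qya|apply: kall_impl Qyb] => u; apply: supp_inW => m
  /= /andP[-> ->]; rewrite ?orbT.
Qed.

(** Another stretch of Mayer-Vietoris: a primitive of [z] in the sum splits as a + b, and z - d(a) =
    d(b) is a cycle in the intersection. *)
Lemma regle_of_union Q1 Q2 r :
  (forall m m', Q1 m -> Q1 (m' + m)%MM) -> (forall m m', Q2 m -> Q2 (m' + m)%MM) ->
  regle (predI Q1 Q2) r -> regle (predU Q1 Q2) r -> regle Q1 r.
Proof.
move=> up1 up2 reg12 regU d z rd Qz dz.
have [|y Qy dy] := regU d z rd _ dz.
  by apply: kall_impl Qz => u; apply: supp_inW => m /= /andP[-> ->].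
have [a [b [def_y Qa Qb]]] : exists a b, [/\ y = a + 1 *: b,
    kin (predI Q1 (degge d.-1)) a & kin (predI Q2 (degge d.-1)) b].
  apply: kall_split Qy => p Qp.
  have [|a [b [-> Qa' Qb']]] := @supp_in_split _ _ (predI Q1 (degge d.-1)) (predI Q2 (degge d.-1)) p.
    by move=> m /Qp /andP[/orP[]Qm dm]; rewrite /= Qm dm ?orbT.
  by exists a, b; rewrite scale1r.
rewrite scale1r in def_y.
have d0 : d = d.-1.+1 by rewrite prednK // (leq_ltn_trans _ rd).
have eq_z : z - kdiff kvar a = kdiff kvar b by rewrite -dy def_y kdiffD addrC addKr.
have [|c Qc dc] := reg12 d (kdiff kvar b) rd _ (kdiffK _ _).
  apply: kall_supp_inI; last by rewrite d0; apply: kdiff_degge.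
  rewrite -eq_z; apply: kinB => //.
  by rewrite d0; apply: kdiff_degge.
exists (a + c); last by rewrite kdiffD dc -eq_z addrC subrK.
apply: kinD => //.
by apply: kall_impl Qc => u; apply: supp_inW => m /andP[/andP[Q1m _] dm]; apply/andP.
Qed.

(** Multiplication by ['X_[e]] is injective, commutes with the differential and raises degrees by
    [mdeg e]. *)
Lemma regle_shift Q e r : regle Q r ->
  regle (fun m => (e <= m)%MM && Q (m - e)%MM) (r + mdeg e).
Proof.
move=> regQ d z rd Qz dz.
(* The first summand is forced to be 0, so this splitting divides all coefficients by ['X_[e]]. *)
have [z0 [w [def_z Qz0 Qw]]] : exists v w, [/\ z = v + ('X_[e] : R) *: w,
    @kall _ R^o (fun u => u = 0) _ v & kin (predI Q (degge (d - mdeg e))) w].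
  apply: kall_split Qz => p Qp.
  have {}Qp m : m \in msupp p -> [/\ (e <= m)%MM, Q (m - e)%MM & degge d m].
    by move=> /Qp /andP[/andP[]].
  have [|q def_p Qq] := @supp_in_div _ _ e p; first by move=> m /Qp[].
  exists 0, q; rewrite add0r; split=> // m /Qq/Qp[_].
  by rewrite addmC addmK /degge mdegD /= addnC => -> dm; rewrite leq_subLR.
have {def_z} : z = ('X_[e] : R) *: w.
  rewrite def_z; by rewrite (kall_eq0 Qz0) add0r.
move=> def_z; have dw : kdiff kvar w = 0.
  have zero_w : 0 + ('X_[e] : R) *: kdiff kvar w = 0 by rewrite add0r -kdiffZ -def_z.
  apply: proj2 (kall_disjoint (P := fun u : R^o => u = 0) _ _ zero_w).
    move=> u v -> /eqP; rewrite add0r mulf_eq0.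
    have /negPf-> : 'X_[e] != 0 :> R by rewrite -msupp_eq0 msuppX.
    by move/eqP.
  exact: kall0.
have [|y Qy dy] := regQ (d - mdeg e)%N w _ Qw dw; first by rewrite ltn_subRL addnC.
exists (('X_[e] : R) *: y); last by rewrite kdiffZ dy.
apply: kall_scale Qy => u; apply: supp_inMX => m /andP[Qm dm].
rewrite /= lem_addr [(e + m)%MM]addmC addmK Qm /degge mdegD.
by move: dm; rewrite /= /degge predn_sub leq_subLR addnC.
Qed.
End Acyclic.

(** * Koszul complexes on free modules, coordinate by coordinate *)

Section RowKoszul.
Variables (R : comNzRingType) (N : nat).

Definition rproj (l : 'I_N) (u : 'rV[R]_N) : R^o := u ord0 l.

Lemma rproj_is_linear l : linear (rproj l).
Proof. by move=> c u v; rewrite /rproj !mxE. Qed.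
HB.instance Definition _ l :=
  GRing.isLinear.Build R 'rV[R]_N R^o _ (rproj l) (rproj_is_linear l).

Lemma kos_row k (y : 'I_N -> kos R^o k) :
  exists w : kos 'rV[R]_N k, forall l, kmap (rproj l) w = y l.
Proof.
elim: k y => [|k IHk] y; first by exists (\row_l y l) => l; rewrite /= /rproj mxE.
have [a def_a] := IHk (fun l => (y l).1); have [b def_b] := IHk (fun l => (y l).2).
by exists (a, b) => l; rewrite kmapS def_a def_b -surjective_pairing.
Qed.

Lemma kos_row_ext k (w w' : kos 'rV[R]_N k) :
  (forall l, kmap (rproj l) w = kmap (rproj l) w') -> w = w'.
Proof.
elim: k w w' => [|k IHk]; first by move=> w w' eq_ww'; apply/rowP => l; apply: eq_ww'.
move=> [a b] [a' b'] eq_ww'.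
have eqa : a = a' by apply: IHk => l; have [] := eq_ww' l.
have eqb : b = b' by apply: IHk => l; have [] := eq_ww' l.
by rewrite eqa eqb.
Qed.

Lemma kall_row (P : 'I_N -> R^o -> Prop) k (w : kos 'rV[R]_N k) :
  kall (fun u => forall l, P l (rproj l u)) w <->
  forall l, kall (P l) (kmap (rproj l) w).
Proof.
elim: k w => [|k IHk] //= [a b]; rewrite !IHk.
by split=> [[Pa Pb] l|Pab] //=; split=> l; have [] := Pab l.
Qed.
End RowKoszul.

(** * Shifts of minimal resolutions bounded by Koszul homology *)

Section Minimal.
Variables (K : fieldType) (n : nat).
Local Notation R := {mpoly K[n]}.

Definition rin N (d : 'I_N -> nat) (u : 'rV[R]_N) : Prop :=
  forall l, supp_in (degge (d l)) (rproj l u).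

(** The 1 in [maxn] puts the coefficients in the maximal ideal; the bound [d] tracks degrees in each
    coordinate. *)
Lemma koszul_acyclic_row N (d : 'I_N -> nat) (z : kos 'rV[R]_N n) :
  kall (rin (fun l => maxn 1 (d l))) z -> kdiff (kvar K n) z = 0 ->
  exists2 y, kall (rin (fun l => (d l).-1)) y & kdiff (kvar K n) y = z.
Proof.
move=> Qz dz.
have {}Qz := proj1 (kall_row (fun l => supp_in (degge (maxn 1 (d l)))) z) Qz.
have [y Hy] : exists y : 'I_N -> kos R^o n, forall l,
    kall (M := R^o) (supp_in (degge (d l).-1)) (y l) /\ kdiff (kvar K n) (y l) = kmap (rproj l) z.
  apply: (@fin_all_exists 'I_N (fun=> kos R^o n) (fun l y =>
    kall (M := R^o) (supp_in (degge (d l).-1)) y /\ kdiff (kvar K n) y = kmap (rproj l) z)) => l.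
  have [|||y Qy dy] := regleT (d := maxn 1 (d l)) (z := kmap (rproj l) z) _.
  - by rewrite leq_max.
  - exact: Qz.
  - by rewrite -kmap_diff dz linear0.
  exists y; split=> //; apply: kall_impl Qy => u; apply: supp_inW => m /=.
  by rewrite /degge; lia.
have [w def_w] := kos_row y.
exists w.
  apply: (proj2 (kall_row (fun l => supp_in (degge (d l).-1)) w)) => l.
  by rewrite def_w; case: (Hy l).
by apply: kos_row_ext => l; rewrite kmap_diff def_w; case: (Hy l).
Qed.

Variables (F : free_complex K n) (I : R -> Prop) (Q : pred 'X_{1..n}) (r : nat).

Definition faug_map (u : 'rV[R]_(frank F 0)) : R^o := (u *m faug F) ord0 ord0.
Lemma faug_map_is_linear : linear faug_map.
Proof. by move=> c u v; rewrite /faug_map mulmxDl -scalemxAl !mxE. Qed.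
HB.instance Definition _ :=
  GRing.isLinear.Build R 'rV[R]_(frank F 0) R^o _ faug_map faug_map_is_linear.

Local Notation D q := (mulmxr (fdiff F q) : 'rV[R]_(frank F q.+1) -> 'rV[R]_(frank F q)).
Local Notation d := (kdiff (kvar K n)).

(** Only the image of [w] one step down the resolution has to be a Koszul cycle; the chase passes
    this condition on. *)
Definition fcycle (q : nat) : kos 'rV[R]_(frank F q) n -> Prop :=
  if q is q'.+1 then fun w => d (kmap (D q') w) = 0 else fun w => d (kmap faug_map w) = 0.

Hypothesis minF : minimal_free_resolution I F.
Hypothesis defI : forall p, I p <-> supp_in Q p.
Hypothesis regQ : regle K Q r.

Lemma fdiff_mdeg q k l m : m \in msupp (fdiff F q k l) ->
  (0 < mdeg m)%N /\ (mdeg m + fshift l = fshift k)%N.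
Proof.
have [[_ grF] _ mF] := minF => mD; split; last exact: grF mD.
rewrite lt0n mdeg_eq0; apply: contraTneq mD => ->.
by rewrite mcoeff_msupp mF eqxx.
Qed.

(* A diagram chase in the double complex with columns the Koszul complexes of the
   [F_q].  The condition on the degrees of the coefficients of [w] says that its
   image in the Koszul complex of [I] has coefficients of degree at least [c]. *)
Lemma koszul_descent c q (w : kos 'rV[R]_(frank F q) n) : (r < c)%N ->
  kall (rin (fun l => c + q - fshift l)%N) w -> fcycle w ->
  exists y u, w = d y + kmap (D q) u.
Proof.
have [[augF grF] [exI ex0 exS] mF] := minF => rc.
elim: q w => [|q IHq] w Qw dw.
  (* The image in the ideal is a cycle with coefficients of degree at least [c], hence a boundary;
     its primitive lifts to [F_0], and exactness absorbs the difference. *)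
  have [|y Qy def_y] := regQ rc _ dw.
    apply: kall_map Qw => u Qu; rewrite /faug_map mxE.
    move=> m mu; apply/andP; split.
      move: m mu; apply/defI/exI; exists u; by rewrite mxE.
    move: m mu; apply: supp_in_sum => l _ _ m /msuppM_le /allpairsP[[m1 m2] /= [m1u m2F ->]].
    have := Qu l m1 m1u; have := augF l m2 m2F; rewrite /degge mdegD; lia.
  have [y0 _ def_y0] : exists2 y0, kall (fun=> True) y0 & y = kmap faug_map y0.
    apply: kall_lift Qy => p Qp; have /exI[u ->] : I p.
      by apply/defI; apply: supp_inW Qp => m /andP[].
    by exists u.
  have [u _ def_u] : exists2 u, kall (fun=> True) u & w - d y0 = kmap (D 0) u.
    have : kmap faug_map (w - d y0) = 0.
      by rewrite kmapB kmap_diff -def_y0 def_y subrr.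
    move/kmap_ker; apply: kall_lift => v v0; have /ex0[u ->] : v *m faug F = 0.
      by apply/matrixP => i j; rewrite !ord1 -[LHS]/(faug_map v) v0 mxE.
    by exists u.
  by exists y0, u; rewrite -def_u addrC subrK.
(* By minimality the image of [w] has coefficients of positive degree, so it is the boundary of some
   [w']; the degree lost fits the passage from [q.+1] to [q]. *)
have [|w' Qw' dw'] := koszul_acyclic_row (d := fun l => (c + q.+1 - fshift l)%N) _ dw.
  apply: kall_map Qw => u Qu l m; rewrite /rproj mxE.
  move: m; apply: supp_in_sum => l' _ _ m /msuppM_le /allpairsP[[m1 m2] /= [m1u m2F ->]].
  have := Qu l' m1 m1u; have [m2_gt0 degm2] := fdiff_mdeg m2F.
  rewrite /degge mdegD; lia.
have cyc_w' : fcycle w'.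
  case: (q) w w' {Qw Qw' IHq dw} dw' => [|q'] w w' dw' /=;
    rewrite -kmap_diff dw'; apply: kmap_comp0 => u /=.
  - rewrite /faug_map; have /ex0 -> : exists v, u *m fdiff F 0 = v *m fdiff F 0 by exists u.
    by rewrite mxE.
  - by apply/exS; exists u.
have [|y [u def_w']] := IHq w' _ cyc_w'.
  apply: kall_impl Qw' => v Qv l m /(Qv l m); rewrite /degge; lia.
(* As [w'] is the image of [u] up to a boundary, [w] and the Koszul differential of [u] have the
   same image, so exactness lifts their difference. *)
have [v _ def_v] : exists2 v, kall (fun=> True) v & w - d u = kmap (D q.+1) v.
  have : kmap (D q) (w - d u) = 0.
    rewrite kmapB kmap_diff -dw' def_w' kdiffD kdiffK add0r.
    by rewrite subrr.
  move/kmap_ker; apply: kall_lift => v v0; have /exS[v' ->] : v *m fdiff F q = 0 := v0.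
  by exists v'.
by exists u, v; rewrite -def_v addrC subrK.
Qed.

(** A basis vector of too large degree, placed in exterior degree 0, would be a Koszul boundary plus
    an image from [F_{i+1}]. Both have zero constant coefficient at [k], the first because of the
    variables, the second by minimality. *)
Theorem min_resolution_regle i (k : 'I_(frank F i)) : (fshift k <= r + i)%N.
Proof.
have [[augF grF] [exI ex0 exS] mF] := minF.
rewrite leqNgt; apply/negP => lt_k; pose e : 'rV[R]_(frank F i) := delta_mx ord0 k.
(* With [c] equal to [fshift k - i], the degree demanded at [k] is 0, which the constant 1 meets. *)
have [|||y [u def_e]] := @koszul_descent (fshift k - i) i (kbase n e).
- by rewrite ltn_subRL addnC.
- apply: kall_base => l; first by rewrite linear0; apply: supp_in0.
  rewrite /rproj mxE eqxx /=; case: eqP => [->|_]; last exact: supp_in0.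
  by move=> m _; rewrite /degge; lia.
- by case: (i) e => [|i'] e /=; rewrite -kmap_diff kdiff_base linear0.
pose P (v : 'rV[R]_(frank F i)) := (v ord0 k)@_0%MM = 0.
have Py : kall P (d y).
  apply: (kall_diff (P := fun=> True)) => //.
  - by rewrite /P mxE mcoeff0.
  - by move=> v w; rewrite /P !mxE mcoeffB => -> ->; rewrite subrr.
  - by move=> j v jn _; rewrite /P mxE (kvarE _ jn) rmorphM /= mcoeffX mnm1_eq0 mul0r.
  
  - exact: kall_true.
have Pu : kall P (kmap (D i) u).
  apply: (kall_map (P := fun=> True)); last exact: kall_true.
  move=> v _; rewrite /P mxE raddf_sum big1 // => l _ /=.
  by rewrite rmorphM /= mF mulr0.
have := kcoef0_base n e; rewrite def_e.
have : P (kcoef0 (d y + kmap (D i) u)).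
  apply: kall_coef0; apply: kall_add Py Pu => v w; rewrite /P mxE mcoeffD => -> ->.
  by rewrite addr0.
rewrite /P => + eq_e; rewrite eq_e /e mxE !eqxx mcoeff1 eqxx => /eqP.
by rewrite oner_eq0.
Qed.
End Minimal.

(** * Ideals generated by variables and quadratic monomials *)

Ltac mnm_lia := rewrite ?mnmDE ?mnm1E -?val_eqE /=; lia.

Section Quadric.
Variables (K : fieldType) (n : nat).
Implicit Types (m e : 'X_{1..n}) (Q : pred 'X_{1..n}) (C : {set 'I_n}) (q : rel 'I_n).

(** The intersection of [Q] with the principal ideal of [e] is the colon ideal shifted by [e], so
    [regle_of_union] applies. *)
Lemma regle_colon Q e r :
  (forall m m', Q m -> Q (m' + m)%MM) ->
  regle K (fun m => Q (e + m)%MM) r -> regle K (fun m => Q m || (e <= m)%MM) (r + mdeg e) ->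
  regle K Q (r + mdeg e).
Proof.
move=> upQ regC regU; apply: (@regle_of_union _ _ Q (fun m => (e <= m)%MM)) => //.
- by move=> m m' em; apply: lepm_trans em (lem_addl _ _).
- apply: eq_regle (regle_shift (e := e) regC) => m /=.
  by case em: (e <= m)%MM; rewrite ?andbF //= addmC submK // andbT.
Qed.

(* The monomials in the ideal generated by the variables in [C] and the products
   [x_u x_v] with [q u v]; squares are allowed. *)
Definition quadric C q : pred 'X_{1..n} := fun m =>
  [exists c, (c \in C) && (m c != 0%N)] ||
  [exists u, exists v, q u v && (U_(u) + U_(v) <= m)%MM].

Lemma quadricP C q m :
  reflect ((exists2 c, c \in C & m c != 0%N) \/
           exists u v, q u v /\ (U_(u) + U_(v) <= m)%MM) (quadric C q m).
Proof.
apply: (iffP orP) => [[/existsP[c /andP[]]|/existsP[u /existsP[v /andP[]]]]|].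
- by left; exists c.
- by right; exists u, v.
- case=> [[c cC mc]|[u [v [quv uvm]]]]; [left|right].
  + by apply/existsP; exists c; rewrite cC.
  + by apply/existsP; exists u; apply/existsP; exists v; rewrite quv.
Qed.

Lemma quadric_up C q m m' : quadric C q m -> quadric C q (m' + m)%MM.
Proof.
move=> /quadricP[[c cC mc]|[u [v [quv uvm]]]]; apply/quadricP.
- by left; exists c => //; rewrite mnmDE addn_eq0 negb_and mc orbT.
- by right; exists u, v; split=> //; apply: lepm_trans uvm (lem_addl _ _).
Qed.

Lemma eq_quadric C q q' : (forall u v, u \notin C -> v \notin C -> q u v = q' u v) ->
  quadric C q =1 quadric C q'.
Proof.
have sub q1 q2 m : (forall u v, u \notin C -> v \notin C -> q1 u v -> q2 u v) ->
    quadric C q1 m -> quadric C q2 m.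
  move=> q12 /quadricP[[c cC mc]|[u [v [quv /mnm_lepP uvm]]]]; apply/quadricP.
    by left; exists c.
  case: (boolP (u \in C)) => [uC|uC]; first by left; exists u => //; have := uvm u; mnm_lia.
  case: (boolP (v \in C)) => [vC|vC]; first by left; exists v => //; have := uvm v; mnm_lia.
  by right; exists u, v; split; [apply: q12|apply/mnm_lepP].
move=> qq' m; apply/idP/idP; apply: sub => u v uC vC; rewrite qq' //.
Qed.

(** Dividing by x_u turns a generator x_u x_v into the variable x_v, and a square of x_u into x_u
    itself. *)
Lemma quadric_colon C q u m : ssrbool.symmetric q -> u \notin C ->
  quadric C q (U_(u) + m)%MM = quadric (C :|: [set v | q u v]) q m.
Proof.
move=> symq uC; apply/quadricP/quadricP.
- case=> [[c cC mc]|[s [t [qst /mnm_lepP stm]]]].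
    left; exists c; first by rewrite inE cC.
    have : u != c by apply: contraNneq uC => ->.
    move: mc; mnm_lia.
  have [us|us] := eqVneq u s.
    left; exists t; first by rewrite !inE us qst orbT.
    by have := stm t; rewrite us; mnm_lia.
  have [ut|ut] := eqVneq u t.
    left; exists s; first by rewrite !inE ut symq qst orbT.
    by have := stm s; rewrite ut; mnm_lia.
  right; exists s, t; split=> //; apply/mnm_lepP => i; have := stm i; move: us ut; mnm_lia.
- case=> [[c]|[s [t [qst /mnm_lepP stm]]]].
    rewrite !inE => /orP[cC|quc] mc.
      by left; exists c => //; move: mc; mnm_lia.
    right; exists u, c; split=> //; apply/mnm_lepP => i.
    by have [->|] := eqVneq i c; move: mc; mnm_lia.
  by right; exists s, t; split=> //; apply/mnm_lepP => i; have := stm i; mnm_lia.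
Qed.

Lemma quadricU1 C q u m : quadric C q m || (U_(u) <= m)%MM = quadric (u |: C) q m.
Proof.
rewrite lep1mP; apply/orP/quadricP => [[/quadricP[[c cC mc]|]|mu]|[[c]|]].
- by left; exists c => //; rewrite !inE cC orbT.
- by right.
- by left; exists u => //; rewrite !inE eqxx.
- rewrite !inE => /orP[/eqP->|cC] mc; [by right|].
  by left; apply/quadricP; left; exists c.
- by move=> stm; left; apply/quadricP; right.
Qed.

(** The colon branch has to gain one in the bound; the other branch keeps the bound and shrinks the
    complement of [C], which serves for induction. *)
Lemma regle_quadric_step C q u r : ssrbool.symmetric q -> u \notin C ->
  regle K (quadric (C :|: [set v | q u v]) q) r -> regle K (quadric (u |: C) q) r.+1 ->
  regle K (quadric C q) r.+1.
Proof.
move=> symq uC regC regU; rewrite -[r.+1]addn1 -(mdeg1 u).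
apply: regle_colon; first exact: quadric_up.
- by apply: eq_regle regC => m; rewrite quadric_colon.
- by rewrite mdeg1 addn1; apply: eq_regle regU => m; rewrite quadricU1.
Qed.

(** Variables are added one at a time with [regle_union]: intersecting the previous ideal with (x_c)
    multiplies it by x_c, which costs exactly the one degree allowed there. *)
Lemma regle_vars C q : (forall u v, u \notin C -> v \notin C -> ~~ q u v) ->
  regle K (quadric C q) 1.
Proof.
pose L C := quadric C (fun _ _ => false) => Cq.
have LP C' m : reflect (exists2 c, c \in C' & m c != 0%N) (L C' m).
  by apply: (iffP (quadricP _ _ _)) => [[|[? [? []]]]|] //; left.
suff regL: regle K (L C) 1.
  apply: eq_regle regL; apply: eq_quadric => u v uC vC; apply: esym; exact: negPf (Cq _ _ uC vC).
elim: {C Cq}#|C| {-2}C (erefl #|C|) => [|k IHk] C.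
  move/eqP; rewrite cards_eq0 => /eqP->; apply: regle_empty => m.
  by apply/negP => /LP[c]; rewrite inE.
move=> cardC; have [c cC] : exists c, c \in C by apply/card_gt0P; rewrite cardC.
have {}IHk : regle K (L (C :\ c)) 1 by apply: IHk; have := cardsD1 c C; rewrite cC; lia.
apply: (@eq_regle _ _ (predU (L (C :\ c)) (fun m => (U_(c) <= m)%MM))).
  by move=> m; rewrite /= quadricU1 setD1K.
apply: regle_union.
- by move=> m m'; apply: quadric_up.
- by move=> m m' em; apply: lepm_trans em (lem_addl _ _).
- exact: IHk.
- have := regle_shift (e := U_(c)%MM) (@regleT K n); rewrite add0n mdeg1.
  by apply: eq_regle => m; rewrite andbT.
- have := regle_shift (e := U_(c)%MM) IHk; rewrite mdeg1 addn1.
  apply: eq_regle => m; rewrite /= lep1mP.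
  case: (m c != 0%N); rewrite /= ?andbF ?andbT //.
  apply/LP/LP => -[i]; rewrite !inE => /andP[ic iC] mi; exists i; rewrite ?inE ?ic //.
    by move: mi; rewrite mnmBE mnm1E [c == i]eq_sym (negPf ic) subn0.
  by rewrite mnmBE mnm1E [c == i]eq_sym (negPf ic) subn0.
Qed.
End Quadric.

(** * Matchings, edge ideals and ideals with cross products *)

Section Graph.
Variables (K : fieldType) (n : nat).
Implicit Types (m : 'X_{1..n}) (C : {set 'I_n}) (G H : graph n).

Definition adj G : rel 'I_n := fun u v => [set u; v] \in edges G.

Lemma adj_sym G : ssrbool.symmetric (adj G).
Proof. by move=> u v; rewrite /adj setUC. Qed.

Lemma adj_neq G u v : adj G u v -> u != v.
Proof. by move/edge_card2; rewrite cards2; case: eqP. Qed.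

(** Bounds the matching number after deletion of [C] without forming the deleted graph, which may
    have isolated vertices or no edge. *)
Definition matching_le G C k : Prop := forall M : {set {set 'I_n}},
  is_matching G M -> (forall e, e \in M -> [disjoint e & C]) -> (#|M| <= k)%N.

Lemma matching_number_le G : matching_le G set0 (matching_number G).
Proof. by move=> M mM _; apply: leq_bigmax_cond. Qed.

Lemma matching_leS G C C' k : C \subset C' -> matching_le G C k -> matching_le G C' k.
Proof. by move=> CC' mk M mM dM; apply: mk => // e /dM; apply: disjointWr. Qed.

(** A matching avoiding [C'] misses [a] and [b], so the edge ab enlarges it to a matching avoiding
    [C]. *)
Lemma matching_le_drop G C C' a b k : adj G a b -> a \notin C -> b \notin C ->
  C \subset C' ->
  (forall e, e \in edges G -> [disjoint e & C'] -> (a \notin e) && (b \notin e)) ->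
  matching_le G C k -> exists2 k', k = k'.+1 & matching_le G C' k'.
Proof.
move=> ab aC bC CC' avoid mk.
have step M : is_matching G M -> (forall e, e \in M -> [disjoint e & C']) -> (#|M| < k)%N.
  move=> /andP[/subsetP subM trivM] dM.
  have dab : {in M, forall e : {set 'I_n}, [disjoint [set a; b] & e]}.
    move=> e eM; have /andP[ae be] := avoid e (subM e eM) (dM e eM).
    by rewrite disjoint_subset; apply/subsetP => v; rewrite !inE => /orP[]/eqP->.
  have [|trivU abM] := trivIsetU1 dab trivM.
    by apply/negP => /subM/edge_card2; rewrite cards0.
  have := mk ([set a; b] |: M); rewrite cardsU1 abM add1n; apply.
    by rewrite /is_matching trivU andbT; apply/subsetP => e; rewrite !inE => /orP[/eqP->|/subM].
  move=> e; rewrite !inE => /orP[/eqP->|/dM]; last exact: disjointWr.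
  by rewrite disjoint_subset; apply/subsetP => v; rewrite !inE => /orP[]/eqP->.
(* Enlarging the empty matching rules out [k = 0]. *)
case: k mk step => [|k] mk step.
  suff: (#|(set0 : {set {set 'I_n}})| < 0)%N by rewrite ltn0.
  apply: step => [|e]; last by rewrite inE.
  by rewrite /is_matching sub0set /trivIset /cover !big_set0 cards0.
by exists k.
Qed.

Lemma disjoint_nbhd G C a e : (forall v, adj G a v -> v \in C) ->
  e \in edges G -> [disjoint e & C] -> a \notin e.
Proof.
move=> nC eG dC; apply/negP => ae; have /eqP/cards2P[u [v [uv def_e]]] := edge_card2 eG.
have vC x : x \in e -> x \notin C by move=> xe; have := disjointFr dC xe => ->.
move: ae; rewrite def_e !inE => /orP[]/eqP a_; move: eG; rewrite def_e -a_.
  by move/nC; apply/negP; apply: vC; rewrite def_e !inE eqxx orbT.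
by rewrite setUC => /nC; apply/negP; apply: vC; rewrite def_e !inE eqxx.
Qed.

(** For an edge uv outside [C], the colon by x_u deletes the neighbours of u, among them v; no
    remaining edge meets u or v, so the matching bound drops. Adding x_u shrinks the complement of
    [C]. *)
Lemma regle_adj G C k : matching_le G C k -> regle K (quadric C (adj G)) k.+1.
Proof.
have [N] := ubnP #|~: C|; elim: N C k => // N IHN C k leN mk.
case: (boolP [exists u, exists v, [&& u \notin C, v \notin C & adj G u v]]); last first.
  move/existsPn => noE; apply: (@regleW _ _ _ 1) => //; apply: regle_vars => u v uC vC.
  by have /existsPn/(_ v) := noE u; rewrite uC vC.
case/existsP=> u /existsP[v /and3P[uC vC uv]].
have ltC C' w : C \subset C' -> w \notin C -> w \in C' -> (#|~: C'| < N)%N.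
  move=> CC' wC wC'; rewrite ltnS in leN; apply: leq_trans leN; apply: proper_card; rewrite properE setCS CC'.
  by apply/subsetPn; exists w; rewrite !inE ?wC ?wC'.
have [k' def_k mk'] : exists2 k', k = k'.+1 & matching_le G (C :|: [set w | adj G u w]) k'.
  apply: (matching_le_drop uv uC vC) mk; first exact: subsetUl.
  move=> e eG de; apply/andP; split.
    by apply: disjoint_nbhd eG de => w; rewrite !inE orbC => ->.
  apply/negP => /(disjointFr de); rewrite !inE uv orbT //.
rewrite def_k; apply: (regle_quadric_step (adj_sym G) uC); last rewrite -def_k; apply: IHN => //.
- by apply: (ltC _ v) => //; [apply: subsetUl|rewrite !inE uv orbT].
- by apply: (ltC _ u) => //; [apply: subsetUr|rewrite !inE eqxx].
- by apply: matching_leS mk; apply: subsetUr.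
Qed.

(* For [ab] an edge of [H], the colon ideal [I(H)I(G) : x_a x_b] is generated by
   the edges of [G] and the [x_u x_v] with [cross] for the neighbourhoods
   [A1], [A2] of [a] and [B1], [B2] of [b] in [H], [G]. *)
Definition cross (A1 A2 B1 B2 : {set 'I_n}) : rel 'I_n := fun u v =>
  (u \in A1) && (v \in B2) || (u \in A2) && (v \in B1).

Definition adjX G (A1 A2 B1 B2 : {set 'I_n}) : rel 'I_n := fun u v =>
  [|| adj G u v, cross A1 A2 B1 B2 u v | cross A1 A2 B1 B2 v u].

Lemma adjX_sym G A1 A2 B1 B2 : ssrbool.symmetric (adjX G A1 A2 B1 B2).
Proof. by move=> u v; rewrite /adjX adj_sym [cross _ _ _ _ u v || _]orbC. Qed.

Section Cross.
Variables (G : graph n) (A1 A2 B1 B2 : {set 'I_n}).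
Hypotheses (sA : A1 \subset A2) (sB : B1 \subset B2).

(** As [A1] lies in [A2] and [B1] in [B2], every cross product has a factor in [A2] and one in
    [B2]. *)
Lemma adjX_killed C : (A2 \subset C) || (B2 \subset C) ->
  quadric C (adjX G A1 A2 B1 B2) =1 quadric C (adj G).
Proof.
move=> AB; apply: eq_quadric => u v uC vC; rewrite /adjX.
suff nX s t : s \notin C -> t \notin C -> cross A1 A2 B1 B2 s t = false by rewrite !nX ?orbF.
move=> sC tC; case/orP: AB => /subsetP ABC.
  have /negPf sA2 : s \notin A2 by apply: contra sC => /ABC.
  have /negPf sA1 : s \notin A1 by apply: contraFN sA2; apply/subsetP.
  by rewrite /cross sA1 sA2.
have /negPf tB2 : t \notin B2 by apply: contra tC => /ABC.
have /negPf tB1 : t \notin B1 by apply: contraFN tB2; apply/subsetP.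
by rewrite /cross tB1 tB2 !andbF.
Qed.

(** The colon by a vertex of [A1] outside [C] deletes [B2], and one by a vertex of [B1] deletes
    [A2]; either removes all cross products, leaving [regle_adj]. *)
Lemma regle_adjX C k : matching_le G C k -> regle K (quadric C (adjX G A1 A2 B1 B2)) k.+2.
Proof.
have [N] := ubnP #|~: C|; elim: N C => // N IHN C leN mk.
have step u : u \notin C -> (A2 \subset C :|: [set v | adjX G A1 A2 B1 B2 u v]) ||
    (B2 \subset C :|: [set v | adjX G A1 A2 B1 B2 u v]) ->
    regle K (quadric C (adjX G A1 A2 B1 B2)) k.+2.
  move=> uC killed; apply: (regle_quadric_step (@adjX_sym G A1 A2 B1 B2) uC).
    apply: (@eq_regle _ _ (quadric (C :|: [set v | adjX G A1 A2 B1 B2 u v]) (adj G))).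
      by move=> m; rewrite adjX_killed.
    by apply: regle_adj; apply: matching_leS mk; apply: subsetUl.
  apply: IHN; last by apply: matching_leS mk; apply: subsetUr.
  rewrite ltnS in leN; apply: leq_trans leN; apply: proper_card; rewrite properE setCS subsetUr.
  by apply/subsetPn; exists u; rewrite !inE ?eqxx.
case: (boolP (A1 \subset C)) => [A1C|/subsetPn[u uA1 uC]]; last first.
  apply: (step u) => //; apply/orP; right; apply/subsetP => v vB2.
  by rewrite !inE /adjX /cross uA1 vB2 !orbT.
case: (boolP (B1 \subset C)) => [B1C|/subsetPn[u uB1 uC]]; last first.
  apply: (step u) => //; apply/orP; left; apply/subsetP => v vA2.
  by rewrite !inE /adjX /cross uB1 vA2 !orbT.
(* With [A1] and [B1] inside [C], no cross product is left. *)
apply: (@eq_regle _ _ (quadric C (adj G))).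
  apply: eq_quadric => u v uC vC; rewrite /adjX.
  have nA s : s \notin C -> (s \in A1) = false by move=> sC; apply: contraNF sC; apply/subsetP.
  have nB s : s \notin C -> (s \in B1) = false by move=> sC; apply: contraNF sC; apply/subsetP.
  by rewrite /cross !nA // !nB // !andbF !orbF.
by apply: regleW (regle_adj mk).
Qed.
End Cross.

(** Three branches: colon by x_a; x_a added, then colon by x_b; both variables added. The matching
    bound drops in each. The drop pays for the degree of the variable in the colons, which kill the
    cross products, and for the cross products in the last branch. *)
Lemma regle_edge_colon G (A1 B1 C : {set 'I_n}) a b k : adj G a b -> a \notin C -> b \notin C ->
  A1 \subset [set v | adj G a v] -> B1 \subset [set v | adj G b v] -> matching_le G C k ->
  regle K (quadric C (adjX G A1 [set v | adj G a v] B1 [set v | adj G b v])) k.+1.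
Proof.
set A2 := [set v | adj G a v]; set B2 := [set v | adj G b v] => ab aC bC sA sB mk.
pose q := adjX G A1 A2 B1 B2.
have sub_q x C' : C' :|: [set v | adj G x v] \subset C' :|: [set v | q x v].
  by apply: setUS; apply/subsetP => v; rewrite !inE /q /adjX => ->.
have [k' def_k mk1] : exists2 k', k = k'.+1 & matching_le G (C :|: [set v | q a v]) k'.
  apply: (matching_le_drop ab aC bC) mk; first exact: subsetUl.
  move=> e eG de; apply/andP; split.
    by apply: disjoint_nbhd eG de => w; rewrite !inE /q /adjX orbC => ->.
  by apply/negP => /(disjointFr de); rewrite !inE /q /adjX ab orbT.
rewrite def_k in mk *.
apply: (regle_quadric_step (@adjX_sym G A1 A2 B1 B2) aC).
  apply: (@eq_regle _ _ (quadric (C :|: [set v | q a v]) (adj G))); last exact: regle_adj.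
  by move=> m; rewrite adjX_killed // (subset_trans (subsetUr C A2) (sub_q a C)).
have bC' : b \notin a |: C by rewrite !inE negb_or bC eq_sym (adj_neq ab).
apply: (regle_quadric_step (@adjX_sym G A1 A2 B1 B2) bC').
  apply: (@eq_regle _ _ (quadric ((a |: C) :|: [set v | q b v]) (adj G))).
    by move=> m; rewrite adjX_killed // (subset_trans (subsetUr (a |: C) B2) (sub_q b _)) orbT.
  apply: regle_adj.
  have [||k'' [<-] //] := matching_le_drop (C' := (a |: C) :|: [set v | q b v]) ab aC bC _ _ mk.
    by rewrite -setUA -setUCA subsetUl.
  move=> e eG de; apply/andP; split.
    by apply/negP => /(disjointFr de); rewrite !inE eqxx.
  by apply: disjoint_nbhd eG de => w bw; rewrite !inE /q /adjX bw !orbT.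
apply: regle_adjX => //.
have [||k'' [<-] //] := matching_le_drop (C' := b |: (a |: C)) ab aC bC _ _ mk.
  by rewrite setUA subsetUr.
move=> e eG de; apply/andP; split; by apply/negP => /(disjointFr de); rewrite !inE eqxx ?orbT.
Qed.

End Graph.

(** * The product ideal and its colons by edges *)

Section Product.
Variables (K : fieldType) (n : nat) (G H : graph n).
Hypothesis HG : subgraph H G.
Implicit Types (m : 'X_{1..n}) (S : {set {set 'I_n}}).

Let sHG u v : adj H u v -> adj G u v.
Proof. by case: HG => _ /subsetP sub; apply: sub. Qed.

Definition prod_monom : pred 'X_{1..n} := fun m =>
  [exists s, exists t, exists u, exists v,
    [&& adj H s t, adj G u v & (U_(s) + U_(t) + (U_(u) + U_(v)) <= m)%MM]].

Lemma prod_monomP m : reflect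
  (exists s t u v, [/\ adj H s t, adj G u v & (U_(s) + U_(t) + (U_(u) + U_(v)) <= m)%MM])
  (prod_monom m).
Proof.
apply: (iffP existsP) => [[s /existsP[t /existsP[u /existsP[v /and3P[]]]]]|].
  by exists s, t, u, v.
move=> [s [t [u [v [st uv le_m]]]]]; exists s; apply/existsP; exists t; apply/existsP; exists u.
by apply/existsP; exists v; apply/and3P.
Qed.

Lemma prod_monom_up m m' : prod_monom m -> prod_monom (m' + m)%MM.
Proof.
move=> /prod_monomP[s [t [u [v [st uv le_m]]]]]; apply/prod_monomP; exists s, t, u, v; split=> //.
exact: lepm_trans le_m (lem_addl _ _).
Qed.

Definition edge_rel S : rel 'I_n := fun u v => [set u; v] \in S.

(** [S] collects the edges of [H] already added to the product as generators. *)
Definition prod_plus S : pred 'X_{1..n} := fun m => prod_monom m || quadric set0 (edge_rel S) m.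

Lemma prod_plusP S m : reflect
  ((exists s t u v, [/\ adj H s t, adj G u v & (U_(s) + U_(t) + (U_(u) + U_(v)) <= m)%MM])
   \/ (exists u v, edge_rel S u v /\ (U_(u) + U_(v) <= m)%MM)) (prod_plus S m).
Proof.
apply: (iffP orP) => [[/prod_monomP|/quadricP[[c]|]]|[/prod_monomP|ex]].
- by left.
- by rewrite inE.
- by right.
- by left.
- by right; apply/quadricP; right.
Qed.

Lemma prod_plus_up S m m' : prod_plus S m -> prod_plus S (m' + m)%MM.
Proof.
move=> /orP[Pm|Sm]; apply/orP; [left|right]; first exact: prod_monom_up.
exact: quadric_up.
Qed.

Lemma lem_cancel (e f m : 'X_{1..n}) : (e + f <= e + m)%MM -> (f <= m)%MM.
Proof. by move=> /mnm_lepP le; apply/mnm_lepP => i; have := le i; rewrite !mnmDE leq_add2l. Qed.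

Lemma lem_disjoint (e f m : 'X_{1..n}) :
  (e <= f + m)%MM -> (forall i, f i != 0%N -> e i = 0%N) -> (e <= m)%MM.
Proof.
move=> /mnm_lepP le dis; apply/mnm_lepP => i; have := le i; rewrite mnmDE.
by have [->|/dis ->] := eqVneq (f i) 0%N.
Qed.

Lemma lem_disjoint2 s t a b m : (U_(s) + U_(t) <= U_(a) + U_(b) + m)%MM ->
  s \notin [set a; b] -> t \notin [set a; b] -> (U_(s) + U_(t) <= m)%MM.
Proof.
move=> /lem_disjoint le; rewrite !inE !negb_or => /andP[sa sb] /andP[ta tb]; apply: le => i.
rewrite !mnmDE !mnm1E; have [<-|_] := eqVneq a i; first by rewrite (negPf sa) (negPf ta).
by have [<-|//] := eqVneq b i; first by rewrite (negPf sb) (negPf tb).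
Qed.

(** In the third case each edge meets {a, b} in exactly one vertex. Distinct such vertices cancel
    and leave the two other endpoints; a common one cancels only once, which leaves a whole edge. *)
Lemma divides_colon a b s t u v m : a != b -> s != t -> u != v ->
  (U_(s) + U_(t) + (U_(u) + U_(v)) <= U_(a) + U_(b) + m)%MM ->
  [\/ (U_(s) + U_(t) <= m)%MM, (U_(u) + U_(v) <= m)%MM |
    exists s' t' u' v', [/\ [set s; t] = [set s'; t'], [set u; v] = [set u'; v'],
      s' \in [set a; b], u' \in [set a; b] &
      (u' = s' /\ (U_(s') + U_(t') <= m)%MM) \/ (u' != s' /\ (U_(t') + U_(v') <= m)%MM)]].
Proof.
move=> ab st uv le_m.
have le1 : (U_(s) + U_(t) <= U_(a) + U_(b) + m)%MM := lepm_trans (lem_addr _ _) le_m.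
have le2 : (U_(u) + U_(v) <= U_(a) + U_(b) + m)%MM := lepm_trans (lem_addl _ _) le_m.
have eq_ab x y : x != y -> x \in [set a; b] -> y \in [set a; b] ->
    (U_(a) + U_(b) = U_(x) + U_(y))%MM.
  by rewrite !inE => /negPf xy /orP[]/eqP xE /orP[]/eqP yE; subst x y;
    rewrite ?eqxx // in xy *; rewrite // addmC.
(* An edge equal to ab cancels completely and leaves the other edge. *)
case: (boolP ((s \in [set a; b]) && (t \in [set a; b]))) => [/andP[sab tab]|nst].
  by constructor 2; move: le_m; rewrite (eq_ab s t) //; apply: lem_cancel.
case: (boolP ((u \in [set a; b]) && (v \in [set a; b]))) => [/andP[uab vab]|nuv].
  by constructor 1; move: le_m; rewrite (eq_ab u v) // addmC; apply: lem_cancel.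
(* An edge disjoint from ab divides [m] by itself, so both edges may be assumed to start in {a,
   b}. *)
wlog sab : s t st le_m le1 nst / s \in [set a; b].
  move=> IH; case: (boolP (s \in [set a; b])) => [|sab]; first exact: IH.
  case: (boolP (t \in [set a; b])) => [|tab]; last first.
    by constructor 1; apply: lem_disjoint2 le1 sab tab.
  rewrite [[set s; t]]setUC [(U_(s) + U_(t))%MM]addmC; apply: IH.
  - by rewrite eq_sym.
  - by rewrite [(U_(t) + U_(s))%MM]addmC.
  - by rewrite addmC.
  - by rewrite andbC.
wlog uab : u v uv le_m le2 nuv / u \in [set a; b].
  move=> IH; case: (boolP (u \in [set a; b])) => [|uab]; first exact: IH.
  case: (boolP (v \in [set a; b])) => [|vab]; last first.
    by constructor 2; apply: lem_disjoint2 le2 uab vab.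
  rewrite [[set u; v]]setUC [(U_(u) + U_(v))%MM]addmC; apply: IH.
  - by rewrite eq_sym.
  - by rewrite [(U_(v) + U_(u))%MM]addmC.
  - by rewrite addmC.
  - by rewrite andbC.
rewrite sab /= in nst; rewrite uab /= in nuv.
constructor 3; exists s, t, u, v; split=> //.
have [us|us] := eqVneq u s; [left|right]; split=> //; last first.
  have eq_us := eq_ab _ _ us uab sab; apply: (@lem_cancel (U_(u) + U_(s))%MM).
  rewrite -eq_us; apply: lepm_trans le_m; apply/mnm_lepP => i; rewrite !mnmDE.
  by have /mnmP/(_ i) := eq_us; rewrite !mnmDE; lia.
have [w eq_sw [ws wt]] : exists2 w, (U_(a) + U_(b) = U_(s) + U_(w))%MM & w != s /\ w != t.
  move: sab nst; rewrite !inE => /orP[]/eqP->; rewrite negb_or ![t == _]eq_sym => /andP[ta tb].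
    by exists b; rewrite // eq_sym.
  by exists a; rewrite // addmC.
have {}le_m : (U_(s) + U_(t) <= U_(w) + m)%MM.
  apply: (@lem_cancel U_(s)%MM); rewrite [(_ + (U_(w) + m))%MM]addmA -eq_sw; apply: lepm_trans le_m.
  by rewrite us; apply/mnm_lepP => i; rewrite !mnmDE; lia.
apply: lem_disjoint le_m _ => i; rewrite !mnmDE !mnm1E; have [<- _|//] := eqVneq w i.
by rewrite eq_sym (negPf ws) eq_sym (negPf wt).
Qed.

Lemma mnm_pairE (u v i : 'I_n) : u != v ->
  (U_(u) + U_(v) : 'X_{1..n})%MM i = (i \in [set u; v]) :> nat.
Proof.
move=> uv; rewrite mnmDE !mnm1E !inE ![i == _]eq_sym.
by have [ui|] := eqVneq u i; rewrite // -ui eq_sym (negPf uv).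
Qed.

(** Edges of [S] meeting ab leave their other endpoint as a variable. As ab is an edge of [H], all
    edges of [G] enter the colon; the cross products come from an edge of [H] at one of a, b and an
    edge of [G] at the other. *)
Lemma prod_plus_colon S a b m : S \subset edges H -> adj H a b -> [set a; b] \notin S ->
  prod_plus S (U_(a) + U_(b) + m)%MM =
  quadric [set c | ([set a; c] \in S) || ([set b; c] \in S)]
    (adjX G [set v | adj H a v] [set v | adj G a v] [set v | adj H b v] [set v | adj G b v]) m.
Proof.
move=> /subsetP sS ab abS; have neq_ab := adj_neq ab.
apply/prod_plusP/quadricP.
- case=> [[s [t [u [v [st uv le_m]]]]]|[u [v [uvS le_m]]]]; last first.
    have shared x y : edge_rel S x y -> (U_(x) + U_(y) <= U_(a) + U_(b) + m)%MM ->
        x \in [set a; b] -> exists2 c,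
          c \in [set c | ([set a; c] \in S) || ([set b; c] \in S)] & m c != 0%N.
      move=> xyS /mnm_lepP/(_ y) + xab; rewrite !mnmDE !mnm1E eqxx => le_y.
      exists y; first by move: xab xyS; rewrite !inE /edge_rel => /orP[]/eqP-> ->; rewrite ?orbT.
      (* Otherwise xy would be the edge ab, which is not in [S]. *)
      have yab : y \notin [set a; b].
        apply: contra abS => yab; suff <- : [set x; y] = [set a; b] by [].
        have xy : x != y by apply: (@adj_neq _ H); apply: sS.
        apply/eqP; rewrite eqEcard !cards2 xy neq_ab andbT subUset !sub1set.
        by rewrite xab yab.
      move: yab; rewrite !inE negb_or ![y == _]eq_sym => /andP[/negPf ay /negPf yb].
      by move: le_y; rewrite ay yb; case: (m y) => //; rewrite addn1.
    case: (boolP (u \in [set a; b])) => [/(shared u v uvS le_m) | uab]; first by left.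
    case: (boolP (v \in [set a; b])) => [vab | vab].
      by left; apply: (shared v u) => //; rewrite ?[(U_(v) + _)%MM]addmC // /edge_rel setUC.
    right; exists u, v; split; first by rewrite /adjX sHG //; apply: sS.
    exact: lem_disjoint2 le_m uab vab.
  right; have [le|le|] := divides_colon neq_ab (adj_neq st) (adj_neq uv) le_m.
  + by exists s, t; rewrite /adjX sHG.
  + by exists u, v; rewrite /adjX uv.
  move=> [s' [t' [u' [v' [eq_st eq_uv sab uab le]]]]].
  rewrite /adj eq_st in st; rewrite /adj eq_uv in uv.
  case: le => [[us le]|[us le]].
    by exists s', t'; split=> //; rewrite /adjX sHG.
  exists t', v'; split=> //; rewrite /adjX /cross !inE.
  move: sab uab us st uv; rewrite !inE => /orP[]/eqP-> /orP[]/eqP->; rewrite ?eqxx // => _.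
    by rewrite /adj => -> ->; rewrite !orbT.
  by rewrite /adj => -> ->; rewrite !orbT.
- case=> [[c]|[u [v [quv le_m]]]].
    rewrite inE => /orP[acS|bcS] mc; right.
      exists a, c; split=> //; apply/mnm_lepP => i; rewrite !mnmDE.
      by have [<-|ci] := eqVneq c i; move: mc; rewrite !mnm1E ?(negPf ci); lia.
    exists b, c; split=> //; apply/mnm_lepP => i; rewrite !mnmDE.
    by have [<-|ci] := eqVneq c i; move: mc; rewrite !mnm1E ?(negPf ci); lia.
  (* Conversely, x_a x_b times a quadratic generator regroups as an edge of [H] times an edge of
     [G]. *)
  have pairs s t u' v' : adj H s t -> adj G u' v' ->
      (U_(s) + U_(t) + (U_(u') + U_(v')) = U_(a) + U_(b) + (U_(u) + U_(v)))%MM ->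
      (exists s t u v, [/\ adj H s t, adj G u v &
         (U_(s) + U_(t) + (U_(u) + U_(v)) <= U_(a) + U_(b) + m)%MM])
       \/ (exists u v, edge_rel S u v /\ (U_(u) + U_(v) <= U_(a) + U_(b) + m)%MM).
    move=> Hst Guv eq_m; left; exists s, t, u', v'; split=> //; rewrite eq_m.
    by apply/mnm_lepP => i; move/mnm_lepP/(_ i): le_m; rewrite !mnmDE; lia.
  case/or3P: quv => [Guv||]; first by apply: (pairs a b u v).
  + rewrite /cross !inE => /orP[/andP[au bv]|/andP[au bv]].
      by apply: (pairs a u b v) => //; apply/mnmP => i; rewrite !mnmDE; lia.
    by apply: (pairs b v a u) => //; apply/mnmP => i; rewrite !mnmDE; lia.
  + rewrite /cross !inE => /orP[/andP[au bv]|/andP[au bv]].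
      by apply: (pairs a v b u) => //; apply/mnmP => i; rewrite !mnmDE; lia.
    by apply: (pairs b u a v) => //; apply/mnmP => i; rewrite !mnmDE; lia.
Qed.

Lemma regle_prod_plus S k : matching_le G set0 k -> S \subset edges H ->
  regle K (prod_plus S) k.+3.
Proof.
move=> mk; have [N] := ubnP #|edges H :\: S|; elim: N S => // N IHN S; rewrite ltnS => leN sS.
have [HS|/subsetPn[e eH eS]] := boolP (edges H \subset S).
  (* Once [S] is all of [edges H], the product is absorbed by I(H), and matchings of [H] are
     matchings of [G]. *)
  have {HS sS} -> : S = edges H by apply/eqP; rewrite eqEsubset sS.
  apply: (@regleW _ _ _ k.+1); first by rewrite ltnW.
  apply: (@eq_regle _ _ (quadric set0 (adj H))).
    move=> m; apply/idP/idP => [Hm|/orP[|//]]; first by rewrite /prod_plus /edge_rel Hm orbT.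
    move=> /prod_monomP[s [t [u [v [st _ le_m]]]]]; apply/quadricP; right; exists s, t; split=> //.
    exact: lepm_trans (lem_addr _ _) le_m.
  apply: regle_adj => M /andP[MH trivM] dM; apply: mk => //; rewrite /is_matching trivM andbT.
  by apply: subset_trans MH _; case: HG.
have /eqP/cards2P[a [b [neq_ab def_e]]] := edge_card2 eH; subst e.
have -> : k.+3 = (k.+1 + mdeg (U_(a) + U_(b))%MM)%N by rewrite mdegD !mdeg1 addn2.
apply: regle_colon; first exact: prod_plus_up.
  pose C := [set c | ([set a; c] \in S) || ([set b; c] \in S)].
  (* Neither a nor b becomes a variable: [S] has no loops and does not contain ab. *)
  have selfS x : [set x; x] \in S = false.
    by apply: contraTF isT => /(subsetP sS)/edge_card2; rewrite cards2 eqxx.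
  have aC : a \notin C by rewrite inE selfS /= setUC.
  have bC : b \notin C by rewrite inE selfS orbF.
  apply: (@eq_regle _ _ (quadric C (adjX G [set v | adj H a v] [set v | adj G a v]
                                           [set v | adj H b v] [set v | adj G b v]))).
    by move=> m; rewrite prod_plus_colon.
  apply: regle_edge_colon => //.
  - exact: sHG.
  - by apply/subsetP => v; rewrite !inE; apply: sHG.
  - by apply/subsetP => v; rewrite !inE; apply: sHG.
  - by apply: matching_leS mk; apply: sub0set.
rewrite mdegD !mdeg1 addn2; apply: (@eq_regle _ _ (prod_plus ([set a; b] |: S))).
  move=> m; apply/prod_plusP/orP.
    case=> [Pm|[u [v [uvS le_m]]]]; first by left; apply/prod_plusP; left.
    move: uvS; rewrite /edge_rel !inE => /orP[/eqP uv|uvS]; last first.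
      by left; apply/prod_plusP; right; exists u, v.
    right; suff <- : (U_(u) + U_(v) = U_(a) + U_(b))%MM by [].
    have neq_uv : u != v by have := neq_ab; have := cards2 u v; rewrite uv cards2; do 2!case: eqP.
    by apply/mnmP => i; rewrite !mnm_pairE // uv.
  case=> [/prod_plusP[Pm|[u [v [uvS le_m]]]]|le_m]; [by left|right|right].
    by exists u, v; split=> //; rewrite /edge_rel !inE [_ \in S]uvS orbT.
  by exists a, b; rewrite /edge_rel !inE eqxx.
apply: IHN.
  apply: leq_trans leN; apply: proper_card; apply/properP; split.
    by apply: setDS; apply: subsetUr.
  by exists [set a; b]; rewrite !inE ?eqxx ?eH ?eS.
by rewrite subUset sub1set eH.
Qed.

Lemma regle_prod_monom k : matching_le G set0 k -> regle K prod_monom k.+3.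
Proof.
move=> mk; apply: eq_regle (regle_prod_plus mk (sub0set _)) => m.
apply/orP/idP => [[//|/quadricP[[c]|[u [v []]]]]|]; rewrite ?inE //; last by left.
by rewrite /edge_rel inE.
Qed.

Lemma ideal_gen_in (R : comNzRingType) (S : R -> Prop) g : S g -> ideal_gen S g.
Proof. by move=> Sg; exists 1%N, (fun=> 1), (fun=> g); rewrite big_ord1 mul1r. Qed.

Lemma ideal_gen_sum (R : comNzRingType) (S : R -> Prop) (J : eqType) (s : seq J) (F : J -> R) :
  (forall j, j \in s -> exists c g, S g /\ F j = c * g) ->
  ideal_gen S (\sum_(j <- s) F j).
Proof.
move=> SF; exists (size s).
pose f := tnth (in_tuple s).
have [c Hc] := @fin_all_exists _ (fun=> R) (fun i c => exists g, S g /\ F (f i) = c * g)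
  (fun i => SF (f i) (mem_tnth i (in_tuple s))).
have [g Hg] := @fin_all_exists _ (fun=> R) (fun i g => S g /\ F (f i) = c i * g) Hc.
exists c, g; split=> [i|]; first by case: (Hg i).
by rewrite big_tnth; apply: eq_bigr => i _; case: (Hg i).
Qed.

Lemma edge_ideal_supp (L : graph n) (p : {mpoly K[n]}) : edge_ideal L p ->
  supp_in (quadric set0 (adj L)) p.
Proof.
case=> k [c [g [Lg ->]]]; apply: supp_in_sum => i _ _.
have [u [v [uvL ->]]] := Lg i; rewrite -mpolyXD.
apply: (@supp_inM _ _ (quadric set0 (adj L))) => [m m'|]; first exact: quadric_up.
by move=> m; rewrite msuppX inE => /eqP->; apply/quadricP; right; exists u, v; rewrite lepm_refl.
Qed.

Lemma ideal_prod_supp (p : {mpoly K[n]}) :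
  ideal_prod (edge_ideal (K := K) H) (edge_ideal (K := K) G) p <-> supp_in prod_monom p.
Proof.
split=> [[k [c [g [HGg ->]]]]|supp_p].
  apply: supp_in_sum => i _ _; have [a [b [Ha Gb ->]]] := HGg i.
  apply: (@supp_inM _ _ prod_monom) => [m m'|]; first exact: prod_monom_up.
  move=> m /msuppM_le /allpairsP[[m1 m2] /= [m1a m2b ->]].
  have /quadricP[[c']|[s [t [st le1]]]] := edge_ideal_supp Ha m1a; first by rewrite inE.
  have /quadricP[[c']|[u [v [uv le2]]]] := edge_ideal_supp Gb m2b; first by rewrite inE.
  apply/prod_monomP; exists s, t, u, v; split=> //; apply/mnm_lepP => i'.
  by have := mnm_lepP le1 i'; have := mnm_lepP le2 i'; rewrite !mnmDE; lia.
rewrite [p]mpolyE; apply: ideal_gen_sum => m /supp_p /prod_monomP[s [t [u [v [st uv le_m]]]]].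
exists (p@_m *: 'X_[m - (U_(s) + U_(t) + (U_(u) + U_(v)))%MM]), (('X_s * 'X_t) * ('X_u * 'X_v)).
split; last by rewrite -scalerAl -!mpolyXD submK.
by exists ('X_s * 'X_t), ('X_u * 'X_v); split=> //; apply: ideal_gen_in; [exists s, t|exists u, v].
Qed.
End Product.

(** * Dickson's lemma and finite generation of submodules *)

Lemma dickson n (P : 'X_{1..n} -> Prop) :
  exists s : seq 'X_{1..n}, (forall m, m \in s -> P m) /\
    (forall m, P m -> exists2 m', m' \in s & (m' <= m)%MM).
Proof.
suff H k : (k <= n)%N -> forall P : 'X_{1..n} -> Prop,
    exists s : seq 'X_{1..n}, (forall m, m \in s -> P m) /\
    (forall m, P m -> exists2 m', m' \in s & forall i : 'I_n, (i < k)%N -> (m' i <= m i)%N).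
  have [s [sP Ps]] := H n (leqnn n) P; exists s; split=> // m /Ps[m' m's le]; exists m' => //; apply/mnm_lepP => i.
  exact/le/ltn_ord.
elim: k => [|k IHk] le_kn {}P.
  case: (classic (exists m, P m)) => [[m Pm]|noP].
    by exists [:: m]; split=> [m'|m' _]; [rewrite inE => /eqP->|exists m; rewrite ?inE].
  by exists [::]; split=> // m Pm; case: noP; exists m.
pose v := Ordinal le_kn; have {}IHk := IHk (ltnW le_kn).
have [s [sP Ps]] := IHk P.
have lt_v (m m' : 'X_{1..n}) : (forall i : 'I_n, (i < k)%N -> (m' i <= m i)%N) ->
    (m' v <= m v)%N -> forall i : 'I_n, (i < k.+1)%N -> (m' i <= m i)%N.
  move=> le_k le_v i; rewrite ltnS leq_eqVlt => /orP[/eqP ik|/le_k//].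
  by rewrite (_ : i = v) //; apply: val_inj.
(* The set [s] serves every [m] whose coordinate at [v] reaches the maximum over [s]; each of the
   finitely many lower slices gets its own finite set. *)
have [s' [s'P Ps']] : exists s' : seq 'X_{1..n}, (forall m, m \in s' -> P m) /\
    (forall m, P m -> (m v < \max_(m' <- s) m' v)%N -> exists2 m', m' \in s' &
       forall i : 'I_n, (i < k.+1)%N -> (m' i <= m i)%N).
  elim: (\max_(m' <- s) _) => [|B [s' [s'P Ps']]]; first by exists [::].
  have [sB [sBP PsB]] := IHk (fun m => P m /\ m v = B).
  exists (sB ++ s'); split=> [m|m Pm].
    by rewrite mem_cat => /orP[/sBP[]|/s'P].
  rewrite ltnS leq_eqVlt => /orP[/eqP mB|/(Ps' m Pm)[m' m's le_m]]; last first.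
    by exists m' => //; rewrite mem_cat m's orbT.
  have [m' m's le_m] := PsB m (conj Pm mB); exists m'; first by rewrite mem_cat m's.
  by apply: lt_v => //; have [_ ->] := sBP m' m's; rewrite mB.
exists (s ++ s'); split=> [m|m Pm]; first by rewrite mem_cat => /orP[/sP|/s'P].
have [lt|ge] := ltnP (m v) (\max_(m' <- s) m' v)%N.
  by have [m' m's le_m] := Ps' m Pm lt; exists m'; rewrite // mem_cat m's orbT.
have [m' m's le_m] := Ps m Pm; exists m'; first by rewrite mem_cat m's.
by apply: lt_v => //; apply: leq_trans ge; rewrite (big_rem m') //= leq_maxl.
Qed.

Section Span.
Variables (R : comNzRingType) (V : lmodType R).

Inductive lspan (S : V -> Prop) : V -> Prop :=
| lspan_0 : lspan S 0
| lspan_cons c u v : S u -> lspan S v -> lspan S (c *: u + v).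

Lemma lspan_in S u : S u -> lspan S u.
Proof. by move=> Su; rewrite -[u]addr0 -[u]scale1r; apply: lspan_cons Su (lspan_0 S). Qed.

Lemma lspan_D S u v : lspan S u -> lspan S v -> lspan S (u + v).
Proof.
by move=> Su Sv; elim: Su => [|c w w' Sw _ IH]; [rewrite add0r|rewrite -addrA; apply: lspan_cons].
Qed.

Lemma lspan_Z S c u : lspan S u -> lspan S (c *: u).
Proof.
elim=> [|c' w w' Sw _ IH]; first by rewrite scaler0; apply: lspan_0.
by rewrite scalerDr scalerA; apply: lspan_cons.
Qed.

Lemma lspan_sum S (I : eqType) (s : seq I) (F : I -> V) :
  (forall i, i \in s -> lspan S (F i)) -> lspan S (\sum_(i <- s) F i).
Proof.
move=> SF; rewrite big_seq; elim/big_ind: _ => [|u v|i]; [exact: lspan_0|exact: lspan_D|exact: SF].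
Qed.

Lemma lspanS (S S' : V -> Prop) u : (forall v, S v -> lspan S' v) -> lspan S u -> lspan S' u.
Proof.
move=> SS'; elim=> [|c w w' /SS' Sw _ IH]; first exact: lspan_0.
by apply: lspan_D IH; apply: lspan_Z.
Qed.

Definition submodule (N : V -> Prop) : Prop :=
  [/\ N 0, forall u v, N u -> N v -> N (u + v) & forall c u, N u -> N (c *: u)].

End Span.

Section Noetherian.
Variables (K : fieldType) (n : nat).
Local Notation R := {mpoly K[n]}.

(** A Groebner basis one coordinate at a time: among elements vanishing before coordinate [j],
    finitely many have leading monomials at [j] dividing all others, and division by them leaves
    elements vanishing at [j] as well. *)
Lemma submodule_fg a (N : 'rV[R]_a -> Prop) : submodule N ->
  exists gs : seq 'rV[R]_a, (forall g, g \in gs -> N g) /\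
    (forall u, N u -> lspan (fun g => g \in gs) u).
Proof.
move=> subN; have [N0 ND NZ] := subN.
pose Nj j u := N u /\ forall l : 'I_a, (l < j)%N -> u ord0 l = 0.
suff: exists gs : seq 'rV[R]_a, (forall g, g \in gs -> N g) /\
    (forall u, Nj 0%N u -> lspan (fun g => g \in gs) u).
  by case=> gs [gsN Ngs]; exists gs; split=> // u Nu; apply: Ngs; split.
have [j] : exists j, (a - j = 0)%N by exists a; rewrite subnn.
suff step k : forall j, (a - j = k)%N -> exists gs : seq 'rV[R]_a, (forall g, g \in gs -> N g) /\
    (forall u, Nj j u -> lspan (fun g => g \in gs) u).
  by move=> _; apply: (step a); rewrite subn0.
elim: k => [|k IHk] {}j aj.
  exists [::]; split=> // u [_ u0]; suff -> : u = 0 by apply: lspan_0.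
  apply/rowP => l; rewrite mxE u0 //; have := ltn_ord l; lia.
have lt_ja : (j < a)%N by lia.
have [gs [gsN Ngs]] := IHk j.+1 ltac:(lia); pose l := Ordinal lt_ja.
have [s [sP Ps]] := @dickson n (fun m => exists u, [/\ Nj j u, u ord0 l != 0 & mlead (u ord0 l) = m]).
have [f Hf] : exists f : 'X_{1..n} -> 'rV[R]_a, forall m, m \in s ->
    [/\ Nj j (f m), f m ord0 l != 0 & mlead (f m ord0 l) = m].
  pose f m := epsilon (inhabits 0) (fun u => [/\ Nj j u, u ord0 l != 0 & mlead (u ord0 l) = m]).
  by exists f => m /sP; apply: epsilon_spec.
exists (gs ++ map f s); split=> [g|u].
  by rewrite mem_cat => /orP[/gsN//|/mapP[m /Hf[[Nf _] _ _] ->]].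
have in_gs v : Nj j v -> v ord0 l = 0 -> lspan (fun g => g \in gs ++ map f s) v.
  move=> [Nv v0] vl; apply: lspanS (Ngs v _) => [g gg|].
    by apply: lspan_in; rewrite mem_cat gg.
  split=> // i; rewrite ltnS leq_eqVlt => /orP[/eqP ij|/v0//].
  by rewrite (_ : i = l) //; apply: val_inj.
move: {2}(mlead _) (erefl (mlead (u ord0 l))) => m.
elim/(well_founded_ind (@ltom_wf n)): m u => m IHm u lead_u Nu.
have [u0|u_neq0] := eqVneq (u ord0 l) 0; first exact: in_gs.
have [m' m's le_m] : exists2 m', m' \in s & (m' <= m)%MM by apply: Ps; exists u.
have [Nf f0 lead_f] := Hf m' m's.
(* [c *: f m'] has the leading term of [u] at [l], so the difference vanishes there or has a smaller
   leading monomial. *)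
pose c : R := (mleadc (u ord0 l) / mleadc (f m' ord0 l)) *: 'X_[m - m'].
have -> : u = c *: f m' + (u - c *: f m') by rewrite addrC subrK.
apply: lspan_D; first by apply/lspan_Z/lspan_in; rewrite mem_cat map_f ?orbT.
have Nu' : Nj j (u - c *: f m').
  case: Nu Nf => Nu u0 [Nf fz]; split.
    by rewrite -scaleN1r; apply: ND => //; exact/NZ/NZ.
  by move=> i ij; rewrite !mxE u0 // fz // mulr0 subrr.
have [u0|u'_neq0] := eqVneq ((u - c *: f m') ord0 l) 0; first exact: in_gs.
apply: (IHm (mlead ((u - c *: f m') ord0 l))) => //; rewrite !mxE in u'_neq0 *.
have c_lead : mlead c = (m - m')%MM.
  by rewrite /c mleadZ ?mleadXm // mulf_neq0 ?invr_neq0 // mleadc_eq0.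
have c_neq0 : c != 0.
  by rewrite scaler_eq0 mulf_eq0 invr_eq0 !mleadc_eq0 (negPf u_neq0) (negPf f0) -msupp_eq0 msuppX.
have lead_cf : mlead (c * f m' ord0 l) = m by rewrite mleadM // c_lead lead_f submK.
have := mleadB_le (u ord0 l) (c * f m' ord0 l); rewrite lead_u lead_cf joinxx.
rewrite le_eqVlt => /orP[/eqP eq_m|//]; case/negP: u'_neq0.
rewrite -mleadc_eq0 eq_m mcoeffB subr_eq0 -{2}lead_cf mleadM // mleadcM.
rewrite c_lead mcoeffZ mcoeffX eqxx mulr1 -lead_u.
by rewrite divfK ?mleadc_eq0.
Qed.
End Noetherian.

(** * Graded submodules and minimal free resolutions *)

Section Graded.
Variables (K : fieldType) (n : nat).
Local Notation R := {mpoly K[n]}.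

Lemma pihomogM d e (p q : R) : q \is e.-homog ->
  pihomog mdeg (d + e) (p * q) = pihomog mdeg d p * q.
Proof.
move=> qe; rewrite {1}[p]mpolyE mulr_suml linear_sum /= pihomogE mulr_suml.
rewrite [RHS]big_mkcond; apply: eq_bigr => m _; rewrite -scalerAl linearZ /=.
have homq : 'X_[m] * q \is (mdeg m + e).-homog by apply: dhomogM; rewrite ?dhomogX.
case: eqP => [md|/eqP md]; first by rewrite pihomog_dE ?scalerAl // -md.
by rewrite (pihomog_ne0 _ homq) ?scaler0 // eqn_add2r.
Qed.

Lemma pihomogM_lt d e (p q : R) : q \is e.-homog -> (d < e)%N -> pihomog mdeg d (p * q) = 0.
Proof.
move=> qe lt_de; rewrite [p]mpolyE mulr_suml linear_sum /= big1 // => m _.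
have homq : 'X_[m] * q \is (mdeg m + e).-homog by apply: dhomogM; rewrite ?dhomogX.
rewrite -scalerAl linearZ /= (pihomog_ne0 _ homq) ?scaler0 //.
by rewrite gtn_eqF // ltn_addl.
Qed.

Lemma pihomog0E (p : R) : pihomog mdeg 0 p = (p@_0%MM)%:MP.
Proof.
rewrite -{1}[p](subrK (p@_0%MM)%:MP) linearD /= [X in _ + X]pihomog_dE; last first.
  apply/dhomogP => m; rewrite mcoeff_msupp mcoeffC.
  by case: (m =P 0%MM) => [-> _|_]; [apply: mdeg0|rewrite mulr0 eqxx].
rewrite pihomogE big1 ?add0r // => m; rewrite mdeg_eq0 => /eqP->.
by rewrite mcoeffB mcoeffC eqxx mulr1 subrr scale0r.
Qed.

Section Shift.
Variables (a : nat) (s : 'I_a -> nat).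

(** The component of degree [d] in the direct sum of the R(- s l); the test guards against truncated
    subtraction. *)
Definition rcomp d (u : 'rV[R]_a) : 'rV[R]_a :=
  \row_l if (s l <= d)%N then pihomog mdeg (d - s l) (u ord0 l) else 0.

Definition rhomog d (u : 'rV[R]_a) : Prop :=
  forall l m, m \in msupp (u ord0 l) -> (mdeg m + s l)%N = d.

Definition graded_sub (N : 'rV[R]_a -> Prop) : Prop := forall d u, N u -> N (rcomp d u).

Lemma rcomp_homog d u : rhomog d (rcomp d u).
Proof.
move=> l m; rewrite mxE; case: leqP => [le|_]; last by rewrite mcoeff_msupp mcoeff0 eqxx.
by have /dhomogP h := @pihomogP _ _ mdeg (d - s l) (u ord0 l); move/h => /= ->; rewrite subnK.
Qed.

Lemma rcomp_sum u : exists B, u = \sum_(d < B) rcomp d u.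
Proof.
pose B := \max_l (s l + msize (u ord0 l))%N; exists B.
apply/rowP => l; rewrite summxE.
have leB : (s l + msize (u ord0 l) <= B)%N by apply: (leq_bigmax l).
rewrite (eq_bigr (fun d : 'I_B =>
  if (s l <= d)%N then pihomog mdeg (d - s l) (u ord0 l) else 0)); last by move=> d _; rewrite mxE.
rewrite -(big_mkord predT (fun d => if (s l <= d)%N then pihomog mdeg (d - s l) (u ord0 l) else 0)).
rewrite (@big_cat_nat _ _ _ (s l)) //=; last exact: leq_trans (leq_addr _ _) leB.
rewrite big1_seq ?add0r; last first.
  by move=> d /andP[_]; rewrite mem_index_iota => /andP[_ ds]; rewrite leqNgt ds.
rewrite -{1}[s l]add0n big_addn big_mkord (eq_bigr (fun d : 'I_(B - s l) => pihomog mdeg d (u ord0 l))).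
  by apply: pihomog_partitionE; rewrite leq_subRL //; apply: leq_trans (leq_addr _ _) leB.
by move=> d _; rewrite leq_addl addnK.
Qed.
End Shift.

Lemma rcomp_mulmx a b (s : 'I_a -> nat) (t : 'I_b -> nat) (D : 'M[R]_(b, a)) d v :
  (forall k, rhomog s (t k) (row k D)) -> rcomp s d (v *m D) = rcomp t d v *m D.
Proof.
move=> homD; apply/rowP => l; rewrite !mxE.
have homDl k : (t k < s l)%N /\ D k l = 0 \/ (s l <= t k)%N /\ D k l \is (t k - s l).-homog.
  have degD m : m \in msupp (D k l) -> (mdeg m + s l)%N = t k.
    by move=> mD; apply: (homD k l m); rewrite mxE.
  case: leqP => [le|lt]; [right|left]; split=> //.
    by apply/dhomogP => m /degD <-; rewrite addnK.
  apply/mpolyP => m; rewrite mcoeff0 memN_msupp_eq0 //; apply/negP => /degD; lia.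
case: leqP => [le|lt]; last first.
  rewrite big1 // => k _; rewrite mxE; case: leqP => [tk|_]; last by rewrite mul0r.
  by case: (homDl k) => [[_ ->]|[]]; [rewrite mulr0|lia].
rewrite linear_sum /=; apply: eq_bigr => k _; rewrite mxE.
case: (homDl k) => [[_ ->]|[st homk]]; first by rewrite !mulr0 linear0.
case: leqP => [tk|tk]; last by rewrite mul0r (pihomogM_lt _ homk) //; lia.
by rewrite -(pihomogM _ _ homk); congr (pihomog _ _ _); lia.
Qed.

Definition generates a b (D : 'M[R]_(b, a)) (N : 'rV[R]_a -> Prop) : Prop :=
  forall u, N u <-> exists v : 'rV_b, u = v *m D.

(** Homogeneous components of the generators stay in a graded submodule, and each generator is a
    finite sum of its components. *)
Lemma graded_gens a (s : 'I_a -> nat) (N : 'rV[R]_a -> Prop) :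
  submodule N -> graded_sub s N ->
  exists b (t : 'I_b -> nat) (D : 'M[R]_(b, a)),
    (forall k, rhomog s (t k) (row k D)) /\ generates D N.
Proof.
move=> subN grN; have [gs [gsN Ngs]] := submodule_fg subN.
have [hs [hsN hsH gshs]] : exists hs : seq (nat * 'rV[R]_a)%type,
   [/\ forall h, h \in hs -> N h.2, forall h, h \in hs -> rhomog s h.1 h.2 &
       forall g, g \in gs -> lspan (fun u => exists2 h, h \in hs & u = h.2) g].
  elim: gs gsN {Ngs} => [|g gs IH] gsN; first by exists [::].
  have [|hs [hsN hsH gshs]] := IH; first by move=> x xgs; apply: gsN; rewrite inE xgs orbT.
  have [B def_g] := rcomp_sum s g.
  have Ng : N g by apply: gsN; rewrite inE eqxx.
  exists ([seq (nat_of_ord d, rcomp s d g) | d <- enum 'I_B] ++ hs); split=> [h|h|x].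
  - by rewrite mem_cat => /orP[/mapP[d _ ->]|/hsN//]; apply: grN.
  - by rewrite mem_cat => /orP[/mapP[d _ ->]|/hsH//]; apply: rcomp_homog.
  - rewrite inE => /orP[/eqP->|/gshs]; last first.
      by apply: lspanS => u [h hhs ->]; apply: lspan_in; exists h; rewrite // mem_cat hhs orbT.
    rewrite [X in lspan _ X]def_g -big_enum; apply: lspan_sum => d _; apply: lspan_in.
    exists (nat_of_ord d, rcomp s d g) => //; rewrite mem_cat; apply/orP; left.
    by apply/mapP; exists d; rewrite ?mem_enum.
pose h := tnth (in_tuple hs).
exists (size hs), (fun k => (h k).1), (\matrix_k (h k).2); split=> [k|u].
  by rewrite rowK; apply/hsH/mem_tnth.
split=> [Nu|[v ->]].
  have : lspan (fun u => exists2 h, h \in hs & u = h.2) u by apply: lspanS (Ngs u Nu) => g /gshs.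
  elim=> [|c g w [x xhs ->] _ [v ->]]; first by exists 0; rewrite mul0mx.
  have /tnthP[k def_x] : x \in in_tuple hs := xhs.
  exists (c *: delta_mx 0 k + v); rewrite mulmxDl -scalemxAl -rowE rowK.
  by rewrite def_x.
case: (subN) => N0 ND NZ; rewrite mulmx_sum_row.
elim/big_ind: _ => // k _; apply: (NZ); rewrite rowK; exact/hsN/mem_tnth.
Qed.

Lemma minimal_gens a (s : 'I_a -> nat) (N : 'rV[R]_a -> Prop) :
  submodule N -> graded_sub s N ->
  exists b (t : 'I_b -> nat) (D : 'M[R]_(b, a)),
    [/\ forall k, rhomog s (t k) (row k D), generates D N &
        forall v : 'rV_b, v *m D = 0 -> forall k, (v ord0 k)@_0%MM = 0].
Proof.
move=> subN grN; have [b [t [D [homD genD]]]] := graded_gens subN grN.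
elim: b t D homD genD => [|b IHb] t D homD genD.
  by exists 0%N, t, D; split=> // v _ [].
case: (classic (exists v : 'rV_b.+1, v *m D = 0 /\ exists k, (v ord0 k)@_0%MM <> 0)); last first.
  move=> no; exists b.+1, t, D; split=> // v vD k; apply: NNPP => vk.
  by case: no; exists v; split=> //; exists k.
case=> v [vD [k0 /eqP vk0]]; apply: (IHb (t \o lift k0) (row' k0 D)) => [k l m|u].
  by have := homD (lift k0 k) l m; rewrite !mxE.
have dropE (w : 'rV[R]_b.+1) : w *m D =
    w ord0 k0 *: row k0 D + (\row_k w ord0 (lift k0 k)) *m row' k0 D.
  rewrite !mulmx_sum_row (bigD1_ord k0) //=; congr (_ + _); apply: eq_bigr => k _.
  by rewrite !mxE; congr (_ *: _); apply/rowP => l; rewrite !mxE.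
pose v' := rcomp t (t k0) v; pose c := (v ord0 k0)@_0%MM.
have v'k0 : v' ord0 k0 = c%:MP.
  by rewrite mxE leqnn subnn pihomog0E.
have [w def_w] : exists w, row k0 D = w *m row' k0 D.
  have := rcomp_mulmx (t k0) v homD; rewrite vD.
  have -> : rcomp s (t k0) 0 = 0.
    by apply/rowP => l; rewrite !mxE linear0 if_same.
  rewrite dropE v'k0 => /esym/eqP; rewrite addr_eq0 => /eqP def_row.
  exists (- (c^-1)%:MP *: \row_k v' ord0 (lift k0 k)).
  rewrite -scalemxAl scaleNr -scalerN -def_row scalerA -mpolyCM mulVf // mpolyC1 scale1r.
  by [].
split=> [/genD[x ->]|[x ->]].
  exists (x ord0 k0 *: w + \row_k x ord0 (lift k0 k)).
  by rewrite dropE mulmxDl -scalemxAl -def_w.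
apply/genD; exists (\row_k if unlift k0 k is Some k' then x ord0 k' else 0).
rewrite dropE mxE unlift_none scale0r add0r; congr (_ *m _).
by apply/rowP => k; rewrite !mxE liftK.
Qed.

Definition syzygies a b (D : 'M[R]_(b, a)) (v : 'rV[R]_b) : Prop := v *m D = 0.

Definition minimal_map a b (s : 'I_a -> nat) (t : 'I_b -> nat) (D : 'M[R]_(b, a)) : Prop :=
  (forall k, rhomog s (t k) (row k D)) /\
  (forall v, syzygies D v -> forall k, (v ord0 k)@_0%MM = 0).

(** Ranks and shifts vary along a resolution; bundling them allows the construction by [iter]. *)
Record stage := Stage {
  st_tgt : nat;
  st_src : nat;
  st_tshift : 'I_st_tgt -> nat;
  st_shift : 'I_st_src -> nat;
  st_map : 'M[R]_(st_src, st_tgt);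
  st_min : minimal_map st_tshift st_shift st_map }.

Definition gens_of a (s : 'I_a -> nat) (N : 'rV[R]_a -> Prop) : Type :=
  {x : {b : nat & (('I_b -> nat) * 'M[R]_(b, a))%type} |
    minimal_map s (projT2 x).1 (projT2 x).2 /\ generates (projT2 x).2 N}.

(** Choice turns existence into data, as the recursive construction requires. *)
Lemma gens_ofP a (s : 'I_a -> nat) (N : 'rV[R]_a -> Prop) :
  submodule N -> graded_sub s N -> gens_of s N.
Proof.
move=> subN grN; apply: constructive_indefinite_description.
have [b [t [D [homD genD minD]]]] := minimal_gens subN grN.
by exists (existT _ b (t, D)).
Qed.

Definition gens_stage a (s : 'I_a -> nat) N (x : gens_of s N) : stage :=
  Stage (proj1 (proj2_sig x)).

Lemma syzygies_sub a b (D : 'M[R]_(b, a)) : submodule (syzygies D).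
Proof.
split=> [|u v|c u]; rewrite /syzygies; first exact: mul0mx.
  by rewrite mulmxDl => -> ->; rewrite addr0.
by rewrite -scalemxAl => ->; rewrite scaler0.
Qed.

Lemma syzygies_graded (S : stage) : graded_sub (@st_shift S) (syzygies (st_map S)).
Proof.
move=> d u Su; rewrite /syzygies -(rcomp_mulmx d u (proj1 (st_min S))) Su.
by apply/rowP => l; rewrite !mxE linear0 if_same.
Qed.

Definition next_gens (S : stage) : gens_of (@st_shift S) (syzygies (st_map S)) :=
  gens_ofP (syzygies_sub (st_map S)) (@syzygies_graded S).

Definition next_stage (S : stage) : stage := gens_stage (next_gens S).

Theorem minimal_resolution_exists (I : R -> Prop) (Q : pred 'X_{1..n}) :
  (forall p, I p <-> supp_in Q p) -> (forall m m', Q m -> Q (m' + m)%MM) ->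
  exists F : free_complex K n, minimal_free_resolution I F.
Proof.
move=> defI upQ; pose N (u : 'rV[R]_1) := I (u ord0 ord0).
have subN : submodule N.
  split=> [|u v|c u]; rewrite /N !defI mxE; first exact: supp_in0.
    exact: supp_inD.
  by apply: supp_inM => m m'; apply: upQ.
have grN : graded_sub (fun=> 0%N) N.
  move=> d u; rewrite /N !defI mxE /= subn0 => Qu.
  by rewrite pihomogE; apply: supp_in_sum => m /Qu Qm _; apply: supp_in_monom.
pose x0 := gens_ofP subN grN; pose S0 := gens_stage x0.
pose st i := iter i next_stage S0.
have stP i : generates (st_map (st i.+1)) (syzygies (st_map (st i))) := (proj2_sig (next_gens (st i))).2.
pose F := @FreeComplex K n (fun i => st_src (st i)) (fun i => @st_shift (st i))
  (fun i => st_map (st i.+1)) (st_map S0).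
exists F; split.
- split=> [k m|i k l m] mF.
    by have := (st_min S0).1 k ord0 m; rewrite mxE addn0; apply.
  by have := (st_min (st i.+1)).1 k l m; rewrite mxE; apply.
- split.
  + move=> p; have := (proj2_sig x0).2 (const_mx p); rewrite /N mxE => ->.
    split=> -[u def_p]; exists u; first by rewrite -[u *m _]def_p mxE.
    by apply/matrixP => i j; rewrite !ord1 mxE def_p.
  + exact: (stP 0%N).
  + by move=> i; apply: (stP i.+1).
(* Rows of a differential are syzygies of the preceding map, whose minimality kills their constant
   coefficients. *)
- move=> i k l; have := (st_min (st i)).2 (row k (st_map (st i.+1))).
  rewrite /= => H; have := H _ l; rewrite mxE; apply.
  by apply/stP; exists (delta_mx ord0 k); rewrite rowE.
Qed.
End Graded.

(** * Existence and bound of the regularity *)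

Lemma bounded_int_max (P : int -> Prop) (x B : int) :
  P x -> (forall y, P y -> y <= B) -> exists2 r, P r & forall y, P y -> y <= r.
Proof.
move=> Px PB; have [N] : exists N : nat, B - x < N%:Z.
  exists (absz (B - x)).+1; have := PB x Px; lia.
elim: N x Px => [|N IHN] x Px ltN; first by have := PB x Px; lia.
case: (classic (exists2 y, P y & x < y)) => [[y Py xy]|no]; first by apply: (IHN y) => //; lia.
by exists x => // y Py; rewrite leNgt; apply/negP => xy; apply: no; exists y.
Qed.

(** The monomial [m0] makes the ideal nonzero, so [F_0] has a generator; the values j - i of nonzero
    Betti numbers then form a nonempty set, bounded by the Koszul argument, and its maximum is the
    regularity. *)
Lemma regularity_le (K : fieldType) (n : nat) (I : {mpoly K[n]} -> Prop) (Q : pred 'X_{1..n})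
    (m0 : 'X_{1..n}) (s : nat) :
  (forall p, I p <-> supp_in Q p) -> (forall m m', Q m -> Q (m' + m)%MM) -> Q m0 ->
  regle K Q s -> exists r : int, regularity I r /\ r <= s%:Z.
Proof.
move=> defI upQ Qm0 regQ.
pose P (x : int) := exists i j b : nat, [/\ graded_betti I i j b, b <> 0%N & x = j%:Z - i%:Z].
have PB x : P x -> x <= s%:Z.
  move=> [i [j [b [[F [minF ->]] b0 ->]]]].
  have [k] : exists k, k \in [set k | @fshift K n F i k == j].
    by apply/card_gt0P; rewrite lt0n; apply/eqP.
  rewrite inE => /eqP <-; have := min_resolution_regle minF defI regQ k; lia.
have [F minF] := minimal_resolution_exists defI upQ.
have [k0 _] : exists k0 : 'I_(frank F 0), true.
  have [_ [genF _ _] _] := minF.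
  have /genF[u] : I 'X_[m0] by apply/defI => m; rewrite msuppX inE => /eqP->.
  rewrite mxE; case: (pickP (fun k : 'I_(frank F 0) => true)) => [k|no]; first by exists k.
  rewrite big1 => [/eqP|k]; last by have := no k.
  by rewrite -msupp_eq0 msuppX.
have Pk0 : P ((fshift k0)%:Z - 0%:Z).
  exists 0%N, (fshift k0), #|[set k | @fshift K n F 0 k == fshift k0]|; split=> //.
    by exists F.
  by apply/eqP; rewrite -lt0n; apply/card_gt0P; exists k0; rewrite inE.
have [r Pr r_max] := bounded_int_max Pk0 PB.
exists r; split; last exact: PB.
by split=> // i j b bij b0; apply: r_max; exists i, j, b.
Qed.

Theorem corollary4p4 (K : fieldType) (n : nat) (G H : graph n)
    (HG : subgraph H G) :
  exists r : int,
    regularity (ideal_prod (@edge_ideal K n H) (@edge_ideal K n G)) r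
    /\ r <= (matching_number G)%:Z + 3.
Proof.
have -> : (matching_number G)%:Z + 3 = (matching_number G).+3%:Z by lia.
(* An edge ab of [H] is also one of [G], so the square of x_a x_b lies in the product. *)
have [e eH] : exists e, e \in edges H by apply/set0Pn; apply: has_edge.
have eG : e \in edges G by case: HG => _ /subsetP; apply.
have /eqP/cards2P[a [b [_ def_e]]] := edge_card2 eH.
apply: (@regularity_le _ _ _ (prod_monom G H) (U_(a) + U_(b) + (U_(a) + U_(b)))%MM).
- exact: ideal_prod_supp.
- exact: prod_monom_up.
- by apply/prod_monomP; exists a, b, a, b; rewrite /adj -def_e eH eG lepm_refl.
- have regP := @regle_prod_monom K n G H HG _ (@matching_number_le n G); exact: regP.
Qed.
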